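(* Let $\alpha,\beta>0$ with $\alpha+\beta<1$. There is a constant $C>0$ such that, if $g$ is a Lipschitz-$\beta$ function on $X$ for which $f=J_\alpha g$ is well defined, then for all $x,y\in X$ $$|f(x)-f(y)|\le C\,[g]_\beta\, d(x,y)^{\alpha+\beta}.$$ In particular, $J_\alpha$ is a continuous linear operator from $C^\beta$ to $C^{\alpha+\beta}$.
   Context: Setting: $(X,d,m)$ is a metric space with a Borel measure $m$ such that $m(X)=\infty$ and, for some $N>0$ (Ahlfors $N$-regularity), $c^{-1}r^N\le m(B(x,r))\le c\,r^N$ for all $x\in X$, $r>0$, with $c$ independent of $x,r$. Approximation of the identity: fix a non-negative decreasing $C^\infty$ function $h:[0,\infty)\to\mathbb{R}$ with $h\equiv1$ on $[0,1/2]$ and $h\equiv0$ on $[2,\infty)$. For $t>0$ let $T_tf(x)=t^{-N}\int_X h(d(x,y)/t)f(y)\,dm(y)$, $\varphi(x,t)=1/T_t1(x)$, $\psi(x,t)=1/T_t\left(\frac{1}{T_t1}\right)(x)$, and $$s(x,y,t)=\frac{\varphi(x,t)\varphi(y,t)}{t^{2N}}\int_X h\left(\tfrac{d(x,z)}{t}\right)h\left(\tfrac{d(y,z)}{t}\right)\psi(z,t)\,dm(z).$$ Bessel potential: for $\alpha>0$, $k_\alpha(x,y)=\alpha\int_0^\infty\frac{t^\alpha}{(1+t^\alpha)^2}s(x,y,t)\frac{dt}{t}$ and $J_\alpha g(x)=\int_X g(z)k_\alpha(x,z)\,dm(z)$. A function $g$ is Lipschitz-$\beta$ if $[g]_\beta=\sup_{x\ne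 y}|g(x)-g(y)|/d(x,y)^\beta<\infty$. $C^\beta$ is the space of bounded Lipschitz-$\beta$ functions, with norm $\|g\|_\infty+[g]_\beta$. ''$J_\alpha g$ is well defined'' means that the defining integral converges absolutely for every $x$. *)

(* Defs.v *)
From HB Require Import structures.
From mathcomp Require Import all_boot all_order all_algebra.
From mathcomp Require Import all_classical all_reals all_analysis.

Set Implicit Arguments.
Unset Strict Implicit.
Unset Printing Implicit Defensive.
Import Order.TTheory GRing.Theory Num.Theory.
Import numFieldNormedType.Exports.

Local Open Scope classical_set_scope.
Local Open Scope ring_scope.

HB.mixin Record Measurable_isBorel (d : measure_display) (R : realType) T
    & Measurable d T & Metric R T := {
  borel_measurableE : @measurable d T = <<s @open T >>
}.

#[short(type="borelMetricType")]
HB.structure Definition BorelMetric (d : measure_display) (R : realType) :=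
  {T of Measurable d T & Metric R T & Measurable_isBorel d R T}.

Definition ahlfors_regular (d : measure_display) (R : realType)
    (X : borelMetricType d R) (m : {measure set X -> \bar R}) (N : R) : Prop :=
  exists2 c : R, 0 < c & forall (x : X) (r : R), 0 < r ->
    ((c^-1 * r `^ N)%:E <= m (ball x r) <= (c * r `^ N)%:E)%E.

(* A function on [0, +oo[ is a function on R whose values on ]-oo, 0[ are
   irrelevant: every clause below only depends on h restricted to [0, +oo[.
   Smoothness is only required at positive points, since at 0 the (one-sided)
   smoothness follows from h being constant on [0, 1/2]. *)
Record cutoff (R : realType) (h : R -> R) : Prop := Cutoff {
  cutoff_ge0 : forall r : R, 0 <= r -> 0 <= h r ;
  cutoff_nonincreasing : forall r s : R, 0 <= r -> r <= s -> h s <= h r ;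
  cutoff_smooth : forall (n : nat) (r : R), 0 < r ->
    derivable (h^`(n))%classic r 1 ;
  cutoff_eq1 : forall r : R, 0 <= r <= 2^-1 -> h r = 1 ;
  cutoff_eq0 : forall r : R, 2 <= r -> h r = 0 }.

Section BesselPotential.
Context (d : measure_display) (R : realType) (X : borelMetricType d R).
Context (m : {measure set X -> \bar R}) (N : R) (h : R -> R).
Implicit Types (f g : X -> R) (x y z : X) (t alpha : R).

Definition approxT t f x : R :=
  t `^ (- N) * \int[m]_y (h (mdist x y / t) * f y).

Definition approx_phi x t : R := (approxT t (cst 1) x)^-1.

Definition approx_psi x t : R :=
  (approxT t (fun y => (approxT t (cst 1) y)^-1) x)^-1.

Definition approx_kernel x y t : R :=
  approx_phi x t * approx_phi y t / t `^ (2 * N) *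
  \int[m]_z (h (mdist x z / t) * h (mdist y z / t) * approx_psi z t).

(* The integrand is nonnegative; the integral can be +oo (e.g. for x = y and
   alpha <= N), hence the extended real values. *)
Definition bessel_kernel alpha x y : \bar R :=
  (alpha%:E * \int[lebesgue_measure]_(t in `]0%R, +oo[)
     (t `^ alpha / (1 + t `^ alpha) ^+ 2 * approx_kernel x y t / t)%:E)%E.

Definition bessel_well_defined alpha g : Prop :=
  forall x, m.-integrable setT (fun z => (g z)%:E * bessel_kernel alpha x z)%E.

Definition bessel_potential alpha g x : R :=
  fine (\int[m]_z ((g z)%:E * bessel_kernel alpha x z))%E.

End BesselPotential.

Section Holder.
Context (R : realType) (X : metricType R).
Implicit Types (beta : R) (g : X -> R).

Definition holder_quotients beta g : set R :=
  [set `|g p.1 - g p.2| / mdist p.1 p.2 `^ beta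
     | p in [set p : X * X | p.1 != p.2]].

Definition lipschitz_exp beta g : Prop := has_ubound (holder_quotients beta g).

(* [sup] is 0 on unbounded sets: meaningful only if [lipschitz_exp beta g]. *)
Definition holder_seminorm beta g : R := sup (holder_quotients beta g).

Definition abs_range g : set R := range (fun x => `|g x|).

Definition sup_norm g : R := sup (abs_range g).

Definition holder_pred beta : {pred X -> R^o} :=
  [pred g | `[< has_ubound (abs_range g) /\ lipschitz_exp beta g >]].

Definition holder_norm beta g : R := sup_norm g + holder_seminorm beta g.

End Holder.

Section HolderSpace.
Context (R : realType) (X : metricType R) (beta : R).
Implicit Types g f : X -> R^o.

Let le_sup_norm g x : has_ubound (abs_range g) -> `|g x| <= sup_norm g.
Proof. by move=> gb; apply: ub_le_sup => //; exists x. Qed.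

Let le_seminorm g x y : lipschitz_exp beta g -> x != y ->
  `|g x - g y| / mdist x y `^ beta <= holder_seminorm beta g.
Proof. by move=> gb xy; apply: ub_le_sup => //; exists (x, y). Qed.

Let sup_le0 (A : set R) c : 0 <= c -> ubound A c -> sup A <= c.
Proof.
move=> c0 Ac; have [->|/set0P A0] := eqVneq A set0; first by rewrite sup0.
exact: ge_sup.
Qed.

Let sup_ge0 (A : set R) : (forall a, A a -> 0 <= a) -> 0 <= sup A.
Proof.
move=> A0; have [[[a Aa] ubA]|/sup_out->//] := pselect (has_sup A).
exact: le_trans (A0 _ Aa) (ub_le_sup ubA Aa).
Qed.

Let sup_norm_ge0 g : 0 <= sup_norm g.
Proof. by apply: sup_ge0 => _ [x _ <-]. Qed.

Let seminorm_ge0 g : 0 <= holder_seminorm beta g.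
Proof. by apply: sup_ge0 => _ [p _ <-]; rewrite divr_ge0// powR_ge0. Qed.

Let ubnormD f g : has_ubound (abs_range f) -> has_ubound (abs_range g) ->
  ubound (abs_range (f + g)) (sup_norm f + sup_norm g).
Proof.
move=> fb gb _ [x _ <-].
by rewrite (le_trans (ler_normD _ _))// lerD// le_sup_norm.
Qed.

Let ubsemiD f g : lipschitz_exp beta f -> lipschitz_exp beta g ->
  ubound (holder_quotients beta (f + g))
    (holder_seminorm beta f + holder_seminorm beta g).
Proof.
move=> fb gb _ [[x y] /= xy <-].
rewrite (le_trans _ (lerD (le_seminorm fb xy) (le_seminorm gb xy)))//.
rewrite -mulrDl ler_wpM2r ?invr_ge0 ?powR_ge0//.
by rewrite opprD addrACA ler_normD.
Qed.

Let ubnormZ (a : R) g : has_ubound (abs_range g) ->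
  ubound (abs_range (a *: g)) (`|a| * sup_norm g).
Proof.
by move=> gb _ [x _ <-]; rewrite normrM ler_wpM2l// le_sup_norm.
Qed.

Let ubsemiZ (a : R) g : lipschitz_exp beta g ->
  ubound (holder_quotients beta (a *: g)) (`|a| * holder_seminorm beta g).
Proof.
move=> gb _ [[x y] /= xy <-].
rewrite [X in `|X|](_ : _ = a * (g x - g y)); last by rewrite mulrBr.
by rewrite normrM -mulrA ler_wpM2l// le_seminorm.
Qed.

Let holder_submod_closed : submod_closed (@holder_pred R X beta).
Proof.
split.
  apply/asboolP; split.
    by exists 0 => _ [x _ <-]; rewrite normr0.
  by exists 0 => _ [[x y] _ <-]; rewrite subrr normr0 mul0r.
move=> a f g /asboolP[fb fl] /asboolP[gb gl].
have fab : has_ubound (abs_range (a *: f)).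
  by eexists; exact: ubnormZ.
have fal : lipschitz_exp beta (a *: f) by eexists; exact: ubsemiZ.
by apply/asboolP; split; [eexists; exact: ubnormD|eexists; exact: ubsemiD].
Qed.

HB.instance Definition _ := GRing.isSubmodClosed.Build R (X -> R^o)
  (@holder_pred R X beta) holder_submod_closed.

Record holder_space := HolderSpace {
  holder_fun :> X -> R^o ;
  holder_funP : holder_fun \in holder_pred beta }.

HB.instance Definition _ := [isSub for holder_fun].
HB.instance Definition _ := [Choice of holder_space by <:].
HB.instance Definition _ := [SubChoice_isSubLmodule of holder_space by <:].

Implicit Types u v : holder_space.

Let holder_bd u : has_ubound (abs_range u).
Proof. by have /asboolP[] := holder_funP u. Qed.

Let holder_lip u : lipschitz_exp beta u.
Proof. by have /asboolP[] := holder_funP u. Qed.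

Let nrm u : R := holder_norm beta u.

Let nrmD u v : nrm (u + v) <= nrm u + nrm v.
Proof.
rewrite /nrm /holder_norm addrACA lerD// sup_le0 ?addr_ge0//.
- by apply: ubnormD; exact: holder_bd.
- by apply: ubsemiD; exact: holder_lip.
Qed.

Let nrmZ_le (a : R) u : nrm (a *: u) <= `|a| * nrm u.
Proof.
rewrite /nrm /holder_norm mulrDr lerD// sup_le0 ?mulr_ge0//.
- by apply: ubnormZ; exact: holder_bd.
- by apply: ubsemiZ; exact: holder_lip.
Qed.

Let nrm_ge0 u : 0 <= nrm u.
Proof. by rewrite addr_ge0. Qed.

Let nrmZ (a : R) u : nrm (a *: u) = `|a| * nrm u.
Proof.
apply/eqP; rewrite eq_le nrmZ_le/=.
have [->|a0] := eqVneq a 0; first by rewrite normr0 mul0r nrm_ge0.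
have := nrmZ_le a^-1 (a *: u).
by rewrite scalerA mulVf// scale1r normfV ler_pdivlMl// normr_gt0.
Qed.

Let nrm_eq0 u : nrm u = 0 -> u = 0.
Proof.
move=> /eqP; rewrite paddr_eq0// => /andP[/eqP u0 _].
apply/val_inj/funext => x /=; apply/eqP.
by rewrite -normr_le0 -u0 le_sup_norm.
Qed.

HB.instance Definition _ :=
  Lmodule_isNormed.Build R holder_space nrmD nrmZ nrm_eq0.

End HolderSpace.

Arguments holder_space {R} X beta.

Lemma holder_normE (R : realType) (X : metricType R) (beta : R)
  (u : holder_space X beta) : `|u| = holder_norm beta u.
Proof. by []. Qed.

(* Main.v *)
(** Write [f = J_alpha g]. The kernels [s(x, ., t)] are nonnegative with total
    mass 1, so the kernels [k_alpha(x, .)] all have the same finite mass and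
    [f x - f y] is the integral, over [(z, t)] in [X * R], of
      [(g z - g x) * w t * (s(x, z, t) - s(y, z, t))]
    with [w t <= alpha * t^(alpha - 1)]. Put [r = d(x, y)].
    If [t <= r], both kernels live in the ball of radius [5 r] around [x], so
    the integral over [z] is at most [2 [g] (5 r)^beta w t].
    If [t > r], they live in the ball of radius [5 t], of measure [O(t^N)], and
    [|s(x, z, t) - s(y, z, t)| = O(t^-N r / t)], so the integral over [z] is
    [O([g] r t^(beta - 1) w t)].
    As [0 < alpha] and [alpha + beta < 1], integrating over [t] gives
    [O([g] r^(alpha + beta))] in both ranges. *)
Require Import Defs.
From HB Require Import structures.
From mathcomp Require Import all_boot all_order all_algebra.
From mathcomp Require Import all_classical all_reals all_analysis.
From mathcomp Require Import measurable_realfun ring lra.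

Set Implicit Arguments.
Unset Strict Implicit.
Unset Printing Implicit Defensive.
Import Order.TTheory GRing.Theory Num.Theory.
Import numFieldNormedType.Exports.

Local Open Scope classical_set_scope.
Local Open Scope ring_scope.

(** * Integrals of powers *)

(** Every exchange of the integrals in [z] and [t] happens on a product sigma-algebra, and
    regularity enters there before any estimate: the upper ball bound makes [m] sigma-finite, and
    both bounds together make [X] separable, without which the distance, although continuous on
    [X * X], could fail to be measurable for the product of the Borel sigma-algebras. The same
    bounds keep T_t 1 and T_t phi above positive constants independent of the point and of [t];
    hence phi and psi are uniformly bounded, and s inherits a Lipschitz estimate from that of [h].
    The kernel k_alpha may be infinite on the diagonal, and [g] may be unbounded. Sums and
    differences of potentials are therefore formed on functions of (z, t), which are finite
    everywhere, and absolute convergence at each point supplies their integrability. Only four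
    properties of s matter for the estimate (positivity, mass 1, support, Lipschitz dependence on
    x), besides joint measurability, so that part is carried out for an abstract family [S]. *)

Section power_integrals.
Context {R : realType}.
Notation mu := (@lebesgue_measure R).
Implicit Types (a b r t : R).

Lemma measurable_powR_EFin (D : set R) a :
  measurable_fun D (fun t => (t `^ a)%:E : \bar R).
Proof.
by apply/measurable_EFinP; apply: (measurable_funS measurableT).
Qed.

(** Staying away from 0, where the integrand blows up if a < 1, makes the fundamental theorem
    applicable. The discarded boundary term e^a / a turns the equality into a bound uniform in
    [e]. *)
Lemma integral_powR_itvcc a e r : 0 < a -> 0 < e -> e < r ->
  (\int[mu]_(t in `[e, r]) (t `^ (a - 1))%:E <= (r `^ a / a)%:E)%E.
Proof.
move=> a0 e0 er.
have dF t : e <= t -> derivable (fun t => a^-1 * t `^ a) t 1.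
  move=> et; apply: derivableM => //.
  by apply: derivable_powR; rewrite in_itv/= andbT (lt_le_trans e0).
have cF t : e <= t -> {for t, continuous (fun t => a^-1 * t `^ a)}.
  by move=> et; apply/differentiable_continuous/derivable1_diffP/dF.
rewrite (@continuous_FTC2 _ _ (fun t => a^-1 * t `^ a)) //.
- by rewrite -EFinB lee_fin [leRHS]mulrC gerBl mulr_ge0 ?invr_ge0 ?powR_ge0// ltW.
- apply: derivable_within_continuous => t; rewrite in_itv/= => /andP[et _].
  by apply: derivable_powR; rewrite in_itv/= andbT (lt_le_trans e0).
- split.
  + by move=> t; rewrite in_itv/= => /andP[/ltW et _]; exact: dF.
  + by apply: cvg_at_right_filter; exact: cF.
  + by apply: cvg_at_left_filter; apply: cF; exact: ltW.
- move=> t; rewrite in_itv/= => /andP[et _].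
  have t0 : 0 < t by rewrite (lt_trans e0).
  have dt : derivable (@powR R ^~ a) t 1.
    by apply: derivable_powR; rewrite in_itv/= andbT.
  rewrite derive1E deriveZ//= -derive1E powR_derive1 ?in_itv/= ?andbT//.
  by rewrite /GRing.scale/= mulrA mulVf ?mul1r// gt_eqF.
Qed.

Lemma integral_powR_near0 a r : 0 < a -> 0 < r ->
  (\int[mu]_(t in `]0%R, r]) (t `^ (a - 1))%:E <= (r `^ a / a)%:E)%E.
Proof.
move=> a0 r0.
(* Exhaustion of ]0, r] for monotone convergence. Starting the denominators at 2 keeps the left end
   strictly below [r] already for n = 0. *)
pose F n : set R := `[r / n.+2%:R, r]%classic.
have -> : `]0, r]%classic = \bigcup_n F n.
  apply/seteqP; split => [t|t [n _]]; rewrite /F/= !in_itv/=.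
    move=> /andP[t0 tr]; have [k] : exists k : nat, r / t < k%:R.
      by exists (Num.bound (r / t)); rewrite archi_boundP// divr_ge0// ltW.
    rewrite ltr_pdivrMr// => rk; exists k => //=; rewrite in_itv/= tr andbT.
    by rewrite ler_pdivrMr// mulrC (le_trans (ltW rk))// ler_wpM2r ?ltW// ltr_nat.
  move=> /andP[rt ->]; rewrite andbT (lt_le_trans _ rt)// divr_gt0//.
have : (\int[mu]_(t in F n) (t `^ (a - 1))%:E @[n --> \oo] -->
    \int[mu]_(t in \bigcup_n F n) (t `^ (a - 1))%:E)%E.
  apply: ge0_nondecreasing_set_cvg_integral => //.
  - apply/nondecreasing_seqP => n; rewrite subsetEset => t.
    rewrite /F/= !in_itv/= => /andP[rt ->]; rewrite andbT (le_trans _ rt)//.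
    by rewrite ler_wpM2l ?(ltW r0)// lef_pV2 ?posrE ?ltr0n// ler_nat.
  - by move=> n; rewrite /F.
  - by move=> n; exact: measurable_powR_EFin.
  - by move=> n t _; rewrite lee_fin powR_ge0.
move=> cvgF; rewrite -(cvg_lim _ cvgF)//; apply: lime_le.
  by apply/cvg_ex; eexists; exact: cvgF.
apply: nearW => n; apply: integral_powR_itvcc => //.
  by rewrite divr_gt0.
by rewrite ltr_pdivrMr// ltr_pMr// ltr1n.
Qed.

Lemma integral_powR_infty b r : 0 < b -> 0 < r ->
  (\int[mu]_(t in `]r, +oo[) (t `^ (- b - 1))%:E = (r `^ (- b) / b)%:E)%E.
Proof.
move=> b0 r0.
have dF t : r <= t -> derivable (fun t => - b^-1 * t `^ (- b)) t 1.
  move=> rt; apply: derivableM => //.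
  by apply: derivable_powR; rewrite in_itv/= andbT (lt_le_trans r0).
have cF t : r <= t -> {for t, continuous (fun t => - b^-1 * t `^ (- b))}.
  by move=> et; apply/differentiable_continuous/derivable1_diffP/dF.
rewrite integral_itv_obnd_cbnd; last exact: measurable_powR_EFin.
rewrite (@ge0_continuous_FTC2y _ _ (fun t => - b^-1 * t `^ (- b)) _ 0).
- by rewrite sub0e -EFinN mulNr opprK mulrC.
- by move=> t _; exact: powR_ge0.
- apply: derivable_within_continuous => t; rewrite in_itv/= => /andP[et _].
  by apply: derivable_powR; rewrite in_itv/= andbT (lt_le_trans r0).
- rewrite -[X in _ --> X](mulr0 (- b^-1)); apply: cvgM; first exact: cvg_cst.
  under eq_fun do rewrite powRN.
  apply/gtr0_cvgV0.
    by near=> t; apply: powR_gt0; near: t; exact: nbhs_pinfty_gt.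
  apply/cvgryPge => A; near=> t.
  have tA : (`|A| + 1) `^ b^-1 <= t by near: t; exact: nbhs_pinfty_ge.
  rewrite (le_trans (ler_norm A))// (@le_trans _ _ (`|A| + 1)) ?lerDl//.
  rewrite -[leLHS]powRr1 ?addr_ge0// -(mulVf (lt0r_neq0 b0)) powRrM.
  by rewrite ge0_ler_powR ?nnegrE ?powR_ge0 ?(ltW b0)// (le_trans _ tA) ?powR_ge0.
- by move=> t /ltW; exact: dF.
- by apply: cvg_at_right_filter; exact: cF.
- move=> t; rewrite in_itv/= => /andP[et _].
  have t0 : 0 < t by rewrite (lt_trans r0).
  have dt : derivable (@powR R ^~ (- b)) t 1.
    by apply: derivable_powR; rewrite in_itv/= andbT.
  rewrite derive1E deriveZ//= -derive1E powR_derive1 ?in_itv/= ?andbT//.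
  by rewrite /GRing.scale/= mulrA mulrNN mulVf ?mul1r// gt_eqF.
Unshelve. all: by end_near. Qed.

(** The common form of both splittings of the [t]-integral: the weight itself is split at 1 with a =
    b = alpha, and the integrated kernel difference at r = d(x, y) with a = alpha and b = 1 - (alpha
    + beta). *)
Lemma integral_le_powR (f : R -> \bar R) a b (A B : R) r :
  0 < a -> 0 < b -> 0 < r -> 0 <= A -> 0 <= B ->
  measurable_fun setT f -> (forall t, 0 <= f t)%E ->
  (forall t, t <= 0 -> f t = 0%E) ->
  (forall t, 0 < t -> t <= r -> (f t <= (A * t `^ (a - 1))%:E)%E) ->
  (forall t, r < t -> (f t <= (B * t `^ (- b - 1))%:E)%E) ->
  (\int[mu]_t f t <= (A * (r `^ a / a) + B * (r `^ (- b) / b))%:E)%E.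
Proof.
move=> a0 b0 r0 A0 B0 mf f0 fneg flow fhigh.
have mfD D : measurable_fun D f by exact: (measurable_funS measurableT).
have -> : (\int[mu]_t f t = \int[mu]_(t in `]0%R, +oo[) f t)%E.
  rewrite [RHS]integral_mkcond; apply: eq_integral => t _.
  rewrite patchE; case: ifPn => //; rewrite notin_setE/= in_itv/= andbT.
  by move/negP; rewrite -leNgt => /fneg.
rewrite (@itv_bndbnd_setU _ _ _ (BRight r)) ?bnd_simp//; last exact: ltW.
have disj : [disjoint `]0, r]%classic & `]r, +oo[%classic].
  apply/disj_setPS => t [/=]; rewrite !in_itv/= andbT => /andP[_ tr].
  by rewrite ltNge tr.
rewrite ge0_integral_setU//; last exact: mfD.
rewrite EFinD leeD//.
  apply: (@le_trans _ _ (\int[mu]_(t in `]0%R, r]) (A%:E * (t `^ (a - 1))%:E))%E).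
    apply: ge0_le_integral => //.
    - exact: mfD.
    - by apply: measurable_funeM; exact: measurable_powR_EFin.
    - by move=> t /=; rewrite in_itv/= => /andP[t0 tr]; rewrite -EFinM flow.
  rewrite ge0_integralZl//; last 2 first.
  - exact: measurable_powR_EFin.
  - by move=> t _; rewrite lee_fin ?powR_ge0.
  by rewrite EFinM lee_wpmul2l// ?integral_powR_near0.
apply: (@le_trans _ _ (\int[mu]_(t in `]r, +oo[) (B%:E * (t `^ (- b - 1))%:E))%E).
  apply: ge0_le_integral => //.
  - exact: mfD.
  - by apply: measurable_funeM; exact: measurable_powR_EFin.
  - by move=> t /=; rewrite in_itv/= => /andP[t0 tr]; rewrite -EFinM fhigh.
rewrite ge0_integralZl//; last 2 first.
- exact: measurable_powR_EFin.
- by move=> t _; rewrite lee_fin ?powR_ge0.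
by rewrite integral_powR_infty// EFinM.
Qed.

End power_integrals.

(** * Ahlfors regular spaces *)

Section borel_metric.
Context {d : measure_display} {R : realType} {X : borelMetricType d R}.
Implicit Types (x y z : X) (f : X -> R).

Lemma measurable_open (A : set X) : open A -> measurable A.
Proof. by move=> oA; rewrite borel_measurableE; exact: sub_sigma_algebra. Qed.

Lemma ler_dist_mdist x y z : `|mdist x z - mdist y z| <= mdist x y.
Proof.
have := metric_triangle x y z; have := metric_triangle y x z.
rewrite (metric_sym y x) ler_norml => h1 h2; apply/andP; split; lra.
Qed.

Lemma continuous_measurable_metric f :
  continuous f -> measurable_fun [set: X] f.
Proof.
move=> /continuousP cf; apply: (measurability _ (RGenOpens.measurableE R)) => //.
move=> _ [_ [a [b ->] <-]]; rewrite setTI; apply: measurable_open.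
exact/cf/interval_open.
Qed.

Lemma continuous_mdist x : continuous (@mdist R X x).
Proof.
move=> y; apply/cvgrPdist_lt => e e0; apply/nbhs_ballP; exists e => //= z.
rewrite ballEmdist/= => yz; apply: le_lt_trans yz.
by rewrite (metric_sym x y) (metric_sym x z) ler_dist_mdist.
Qed.

Lemma measurable_mdist x : measurable_fun [set: X] (@mdist R X x).
Proof. exact/continuous_measurable_metric/continuous_mdist. Qed.

Lemma measurable_metric_ball x (r : R) : measurable (ball x r).
Proof.
have -> : ball x r = @mdist R X x @^-1` `]-oo, r[%classic.
  by rewrite ballEmdist; apply/seteqP; split => y /=; rewrite in_itv.
by rewrite -[X in measurable X]setTI; exact: measurable_mdist.
Qed.

End borel_metric.

Section ahlfors.
Context {d : measure_display} {R : realType} {X : borelMetricType d R}.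
Variables (m : {measure set X -> \bar R}) (N c : R).
Hypotheses (c0 : 0 < c) (mreg : forall (x : X) (r : R), 0 < r ->
  ((c^-1 * r `^ N)%:E <= m (ball x r) <= (c * r `^ N)%:E)%E).
Implicit Types x y z : X.

Lemma ahlfors_ball_le x r : 0 < r -> (m (ball x r) <= (c * r `^ N)%:E)%E.
Proof. by move=> /(mreg x)/andP[]. Qed.

Lemma ahlfors_ball_ge x r : 0 < r -> ((c^-1 * r `^ N)%:E <= m (ball x r))%E.
Proof. by move=> /(mreg x)/andP[]. Qed.

Lemma bigcup_ball x : \bigcup_n ball x n.+1%:R = [set: X].
Proof.
apply/seteqP; split => // y _; exists (Num.bound (mdist x y)) => //=.
rewrite ballEmdist/=; have /lt_le_trans := archi_boundP (mdist_ge0 x y); apply.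
by rewrite ler_nat.
Qed.

Lemma ahlfors_sigma_finite x : sigma_finite [set: X] m.
Proof.
exists (fun n => ball x n.+1%:R); first by rewrite bigcup_ball.
move=> n; split; first exact: measurable_metric_ball.
by rewrite (le_lt_trans (ahlfors_ball_le x _)) ?ltry.
Qed.

(* Disjoint balls centred in a fixed ball have measure bounded below, so only
   finitely many of them fit in a larger ball. *)
Lemma ahlfors_totally_bounded x (r e : R) : 0 < r -> 0 < e ->
  exists s : seq X, forall y, mdist x y < r -> exists2 q, q \in s & mdist q y < e.
Proof.
move=> r0 e0; apply: contrapT => nots.
have far (s : seq X) : exists2 y,
    mdist x y < r & forall q, q \in s -> e <= mdist q y.
  apply: contrapT => noty; apply: nots; exists s => y xy.
  apply: contrapT => noq; apply: noty; exists y => // q qs.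
  by rewrite leNgt; apply/negP => qy; apply: noq; exists q.
pose U (s : seq X) := [set z | exists2 q, q \in s & ball q (e / 2) z].
pose dl := c^-1 * (e / 2) `^ N.
have dl0 : 0 < dl by rewrite mulr_gt0 ?invr_gt0 ?powR_gt0 ?divr_gt0.
have packing n : exists s, [/\ measurable (U s), U s `<=` ball x (r + e) &
    ((n%:R * dl)%:E <= m (U s))%E].
  elim: n => [|n [s [mUs Us ns]]].
    exists [::]; have -> : U [::] = set0 by apply/seteqP; split => // z [].
    by split => //; rewrite mul0r measure0.
  have [y xy ys] := far s; exists (y :: s).
  have UE : U (y :: s) = ball y (e / 2) `|` U s.
    apply/seteqP; split => z.
      move=> [q]; rewrite in_cons => /orP[/eqP -> |qs qz]; first by left.
      by right; exists q.
    case=> [yz|[q qs qz]]; first by exists y => //; rewrite in_cons eqxx.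
    by exists q => //; rewrite in_cons qs orbT.
  have mB := @measurable_metric_ball _ _ X y (e / 2).
  rewrite UE; split; first exact: measurableU.
  - move=> z [|/Us//]; rewrite !ballEmdist/= => yz.
    by have := metric_triangle x y z; lra.
  - rewrite measureU//; last first.
      apply/seteqP; split => // z [+ [q qs]]; rewrite !ballEmdist/= => yz qz.
      have := ys _ qs; have := metric_triangle q z y.
      by rewrite (metric_sym z y); lra.
    rewrite -natr1 mulrDl mul1r EFinD addeC leeD//.
    by apply: ahlfors_ball_ge; rewrite divr_gt0.
have [s [mUs Us]] := packing (Num.bound (c * (r + e) `^ N / dl)).
apply/negP; rewrite -ltNge.
apply: (@le_lt_trans _ _ (c * (r + e) `^ N)%:E).
  apply: le_trans (ahlfors_ball_le x _); last by rewrite addr_gt0.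
  by apply: le_measure; rewrite ?inE//; exact: measurable_metric_ball.
rewrite lte_fin -ltr_pdivrMr// archi_boundP// divr_ge0 ?(ltW dl0)//.
by rewrite mulr_ge0 ?powR_ge0// ltW.
Qed.

(** The dense sequence runs through finite nets of mesh 1/(j+1) for the balls of radius i+1 around
    [x]. Its index encodes the pair (i, j) and a position in the net; codes without meaning give
    [x]. *)
Lemma ahlfors_separable x :
  exists q : nat -> X, forall y e, 0 < e -> exists n, mdist (q n) y < e.
Proof.
have /choice[F FP] (p : nat * nat) : exists s : seq X, forall y,
    mdist x y < p.1.+1%:R -> exists2 q, q \in s & mdist q y < p.2.+1%:R^-1.
  by apply: ahlfors_totally_bounded; rewrite ?invr_gt0.
exists (fun k => if unpickle k is Some (p, i) then nth x (F p) i else x).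
move=> y e e0.
pose p := (Num.bound (mdist x y), Num.bound e^-1).
have [|q qF qy] := FP p y.
  have /lt_le_trans := archi_boundP (mdist_ge0 x y); apply.
  by rewrite ler_nat.
exists (pickle (p, index q (F p))); rewrite pickleK nth_index//.
rewrite (lt_trans qy)// -[ltRHS]invrK ltf_pV2 ?posrE ?invr_gt0//.
have e'0 : 0 <= e^-1 by rewrite invr_ge0 ltW.
by have /lt_le_trans := archi_boundP e'0; apply; rewrite ler_nat.
Qed.

(** Along a dense sequence, d(y, z) < r holds exactly when d(q_n, y) + d(q_n, z) < r for some n.
    This writes the preimage of a ray as a countable union of sets that are measurable for the
    product sigma-algebra. *)
Lemma ahlfors_measurable_mdist :
  measurable_fun [set: X * X] (fun p => mdist p.1 p.2).
Proof.
have [q qP] := ahlfors_separable point.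
apply: (measurability _ (RGenInftyO.measurableE R)) => //.
move=> _ [_ [r ->] <-]; rewrite setTI.
have -> : (fun p : X * X => mdist p.1 p.2) @^-1` `]-oo, r[ =
    \bigcup_n ((fun p : X * X => mdist (q n) p.1 + mdist (q n) p.2) @^-1`
      `]-oo, r[%classic).
  apply/seteqP; split => [[y z]|[y z] [n _]]; rewrite /= !in_itv/=.
    (* Half of the slack, because d(q_n, y) is spent twice: once directly and once in bounding
       d(q_n, z). *)
    move=> yzr; have [|n qn] := qP y ((r - mdist y z) / 2); first lra.
    exists n => //=; rewrite in_itv/=.
    by have := metric_triangle (q n) y z; lra.
  by have := metric_triangle y (q n) z; rewrite (metric_sym y (q n)); lra.
apply: bigcup_measurable => n _; rewrite -[X in measurable X]setTI.
apply: measurable_funD => //.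
  exact: measurableT_comp (measurable_mdist (q n)) measurable_fst.
exact: measurableT_comp (measurable_mdist (q n)) measurable_snd.
Qed.

End ahlfors.

(** * Cutoff functions *)

Section cutoff_clamp.
Context {R : realType}.
Variable h : R -> R.
Hypothesis hcut : cutoff h.

(* The values of a cutoff on ]-oo, 0[ are arbitrary; clamping the argument
   gives a function with the same values on [0, +oo[ which is Lipschitz, hence
   measurable, on the whole line. *)
Definition clamp_cutoff (r : R) : R := h (Num.max 2^-1 (Num.min r 2)).

Lemma clamp_cutoffE r : 0 <= r -> clamp_cutoff r = h r.
Proof.
move=> r0; rewrite /clamp_cutoff.
have half2 : (2^-1 : R) <= 2 by lra.
have [r2|r2] := leP r 2.
  have [r12|r12] := leP (2^-1) r => //.
  by rewrite !(cutoff_eq1 hcut)// ?r0 ?(ltW r12)// lexx andbT.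
by rewrite (max_idPr _)// !(cutoff_eq0 hcut)// ltW.
Qed.

Lemma clamp_cutoff_eq1 r : r <= 2^-1 -> clamp_cutoff r = 1.
Proof.
move=> r12; rewrite /clamp_cutoff (max_idPl _) ?ge_min ?r12//.
by rewrite (cutoff_eq1 hcut)// lexx andbT.
Qed.

Lemma clamp_cutoff_eq0 r : 2 <= r -> clamp_cutoff r = 0.
Proof.
by move=> r2; rewrite clamp_cutoffE ?(cutoff_eq0 hcut)// (le_trans _ r2).
Qed.

Lemma clamp_cutoff_ge0 r : 0 <= clamp_cutoff r.
Proof. by apply: (cutoff_ge0 hcut); rewrite le_max invr_ge0 ler0n. Qed.

Lemma clamp_cutoff_le1 r : clamp_cutoff r <= 1.
Proof.
have <- : h 2^-1 = 1 by rewrite (cutoff_eq1 hcut)// lexx andbT.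
by apply: (cutoff_nonincreasing hcut); rewrite // le_max lexx.
Qed.

(** Clamping is nondecreasing and 1-Lipschitz with values in [1/2, 2], a compact set of positive
    points on which h' is continuous. The maximum of |h'| there is the constant, by the mean value
    theorem. *)
Lemma clamp_cutoff_lipschitz :
  exists2 L : R, 0 <= L & forall a b,
    `|clamp_cutoff a - clamp_cutoff b| <= L * `|a - b|.
Proof.
have half2 : (2^-1 : R) <= 2 by lra.
have h1 r : 0 < r -> derivable h r 1 := cutoff_smooth hcut (n := 0%N) (r := r).
have h2 r : 0 < r -> derivable h^`()%classic r 1
  := cutoff_smooth hcut (n := 1%N) (r := r).
have pos r : r \in `[2^-1, 2] -> 0 < r.
  by rewrite in_itv/= => /andP[r12 _]; rewrite (lt_le_trans _ r12).
have [|c _ cmax] := @EVT_max _ (fun r => `|h^`()%classic r|) _ _ half2.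
  apply: continuous_in_subspaceT => r; rewrite inE/= => /pos r0.
  apply: (@continuous_comp _ _ _ h^`()%classic (@Num.norm R R)).
    exact/differentiable_continuous/derivable1_diffP/h2.
  exact: norm_continuous.
exists `|h^`()%classic c| => // a b.
pose p r : R := Num.max 2^-1 (Num.min r 2).
have pI r : p r \in `[2^-1, 2].
  by rewrite in_itv/= le_max lexx ge_max half2 ge_min lexx orbT.
have pL r s : r <= s -> 0 <= p s - p r <= s - r.
  move=> rs; rewrite /p; case: (leP r 2) => r2; case: (leP s 2) => s2;
  case: (leP 2^-1 r) => r12; case: (leP 2^-1 s) => s12;
  rewrite ?(max_idPr half2); apply/andP; split; lra.
wlog ab : a b / a <= b.
  move=> W; have [/W//|/ltW/W] := leP a b.
  by rewrite distrC (distrC b).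
have /andP[pab0 pab] := pL _ _ ab.
rewrite /clamp_cutoff -/(p a) -/(p b) distrC (distrC a).
have pab' : p a <= p b by rewrite -subr_ge0.
have sub r : r \in `[p a, p b] -> r \in `[2^-1, 2].
  rewrite !in_itv/= => /andP[ar rb].
  move: (pI a) (pI b); rewrite !in_itv/= => /andP[a1 _] /andP[_ b2].
  by rewrite (le_trans a1 ar) (le_trans rb b2).
have [||r rab ->] := @MVT_segment _ h h^`()%classic (p a) (p b) pab'.
- move=> r rab; have r0 : 0 < r.
    by apply: pos; apply: sub; exact: subset_itv_oo_cc rab.
  by rewrite derive1E; apply/derivableP/h1.
- apply: derivable_within_continuous => r rab.
  by apply: h1; apply: pos; exact: sub.
- rewrite normrM ler_pM// ?cmax ?sub//.
  by rewrite (ger0_norm pab0) (le_trans pab)// ler_norm.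
Qed.

End cutoff_clamp.

Section real_measurability.
Context {d : measure_display} {T : measurableType d} {R : realType}.

Lemma lipschitz_continuous_real (f : R -> R) (L : R) :
  (forall a b, `|f a - f b| <= L * `|a - b|) -> continuous f.
Proof.
move=> fL a; apply/cvgrPdist_lt => e e0; near=> b.
rewrite (le_lt_trans (fL _ _))//.
have L1 : 0 < `|L| + 1 by rewrite ltr_wpDl.
rewrite (@le_lt_trans _ _ ((`|L| + 1) * `|a - b|))//.
  by rewrite ler_wpM2r// (le_trans (ler_norm L))// lerDl.
rewrite -ltr_pdivlMl// mulrC.
by near: b; apply: cvgr_dist_lt => //; rewrite divr_gt0.
Unshelve. all: by end_near. Qed.

(** Measurability of real powers gives the inverse of |f|; the identity 1/f = f * (1/|f|)^2 restores
    the sign. It also holds where f vanishes, since the inverse of 0 is 0. *)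
Lemma measurable_fun_invr (f : T -> R) :
  measurable_fun setT f -> measurable_fun setT (fun x => (f x)^-1).
Proof.
move=> mf.
have -> : (fun x => (f x)^-1) = (fun x => f x * (`|f x| `^ (-1)) ^+ 2).
  apply/funext => x; rewrite powR_inv1//.
  have [->|fx0] := eqVneq (f x) 0; first by rewrite invr0 mul0r.
  rewrite exprVn real_normK ?num_real// expr2 invfM mulrA divff// mul1r//.
apply: measurable_funM => //; apply: measurable_funX.
apply: (measurableT_comp (f := fun y : R => y `^ (-1))) => //.
exact: measurableT_comp.
Qed.

End real_measurability.

(** * Integrals of bounded functions supported in a set of controlled measure *)

Section integral_le_support.
Context {d : measure_display} {T : measurableType d} {R : realType}.
Variables (mu : {measure set T -> \bar R}) (B : set T) (b M : R) (u : T -> R).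
Hypotheses (mB : measurable B) (muB : (mu B <= b%:E)%E) (M0 : 0 <= M)
  (mu_ : measurable_fun setT u) (uM : forall z, `|u z| <= M)
  (uB : forall z, ~ B z -> u z = 0).

Lemma integral_normr_le_support : (\int[mu]_z `|u z|%:E <= (M * b)%:E)%E.
Proof.
apply: (@le_trans _ _ (\int[mu]_z (M * \1_B z)%:E)%E).
  apply: ge0_le_integral => //.
  - by apply/measurable_EFinP; exact: measurableT_comp.
  - apply/measurable_EFinP; apply: measurable_funM => //.
  - move=> z _; rewrite lee_fin indicE.
    have [zB|zB] := boolP (z \in B); first by rewrite mulr1.
    by rewrite uB ?normr0 ?mulr0//; move/negP: zB; rewrite inE.
under eq_integral do rewrite EFinM.
rewrite ge0_integralZl//; last exact/measurable_EFinP.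
by rewrite integral_indic// setIT EFinM lee_wpmul2l.
Qed.

Lemma integrable_le_support : mu.-integrable setT (EFin \o u).
Proof.
apply/integrableP; split; first exact/measurable_EFinP.
by rewrite (le_lt_trans integral_normr_le_support)// ltry.
Qed.

Lemma normr_Rintegral_le_support : `|\int[mu]_z u z| <= M * b.
Proof.
rewrite -lee_fin (le_trans _ integral_normr_le_support)//.
rewrite EFin_normr_Rintegral//; last exact: integrable_le_support.
by apply: le_abse_integral => //; exact/measurable_EFinP.
Qed.

End integral_le_support.

(** * The approximation kernel *)

Section approximation_kernel.
Context {d : measure_display} {R : realType} {X : borelMetricType d R}.
Variables (m : {sigma_finite_measure set X -> \bar R}) (N c L : R) (h : R -> R).
Hypotheses (c0 : 0 < c) (mreg : forall (x : X) (r : R), 0 < r ->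
  ((c^-1 * r `^ N)%:E <= m (ball x r) <= (c * r `^ N)%:E)%E).
Hypotheses (h_ge0 : forall r, 0 <= h r) (h_le1 : forall r, h r <= 1)
  (h_eq1 : forall r, r <= 2^-1 -> h r = 1) (h_eq0 : forall r, 2 <= r -> h r = 0)
  (L0 : 0 <= L) (hL : forall a b, `|h a - h b| <= L * `|a - b|).
Implicit Types (x y z : X) (t : R).

Let mh : measurable_fun [set: R] h.
Proof.
by apply: continuous_measurable_fun; exact: lipschitz_continuous_real hL.
Qed.

Section measurability.
Context {d' : measure_display} {T : measurableType d'}.
Variables (x y : T -> X) (t : T -> R).
Hypotheses (mx : measurable_fun setT x) (my : measurable_fun setT y)
  (mt : measurable_fun setT t).

(** Points and scale are measurable functions of a parameter in any space [T]. One family of lemmas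
    thus serves a fixed scale ([T] = [X]), the double integral behind the mass of the kernel
    ([X * X]) and the mixture over scales ([X * R]). *)
Lemma measurable_cutoff_mdist :
  measurable_fun setT (fun w => h (mdist (x w) (y w) / t w)).
Proof.
apply: measurableT_comp => //; apply: measurable_funM.
  apply: (measurableT_comp (f := fun p : X * X => mdist p.1 p.2)
    (g := fun w => (x w, y w))).
    exact: (@ahlfors_measurable_mdist _ _ _ m N c).
  exact: measurable_fun_pair.
exact: measurable_fun_invr.
Qed.

Lemma measurable_Rintegral_param (G : T * X -> R) : (forall p, 0 <= G p) ->
  measurable_fun setT G -> measurable_fun setT (fun w => \int[m]_z G (w, z)).
Proof.
move=> G0 mG; apply: measurableT_comp => //.
apply: (measurable_fun_fubini_tonelli_F (EFin \o G)).
  exact/measurable_EFinP.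
by move=> p; rewrite lee_fin.
Qed.

End measurability.

Lemma measurable_approxT {d' : measure_display} {T : measurableType d'}
    (x : T -> X) (t : T -> R) (f : T -> X -> R) :
  measurable_fun setT x -> measurable_fun setT t ->
  (forall w z, 0 <= f w z) ->
  measurable_fun setT (fun p : T * X => f p.1 p.2) ->
  measurable_fun setT (fun w => approxT m N h (t w) (f w) (x w)).
Proof.
move=> mx mt f0 mf; apply: measurable_funM.
  by apply: (measurableT_comp (f := fun r : R => r `^ (- N))).
apply: (measurable_Rintegral_param
  (G := fun p => h (mdist (x p.1) p.2 / t p.1) * f p.1 p.2)).
  by move=> p; rewrite mulr_ge0.
apply: measurable_funM => //; apply: measurable_cutoff_mdist => //.
  exact: measurableT_comp.
exact: measurableT_comp.
Qed.

Lemma approxT_ge0 t f x : (forall z, 0 <= f z) -> 0 <= approxT m N h t f x.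
Proof.
move=> f0; rewrite mulr_ge0 ?powR_ge0// Rintegral_ge0// => z _.
by rewrite mulr_ge0.
Qed.

Lemma measurable_approx_phi {d' : measure_display} {T : measurableType d'}
    (x : T -> X) (t : T -> R) :
  measurable_fun setT x -> measurable_fun setT t ->
  measurable_fun setT (fun w => approx_phi m N h (x w) (t w)).
Proof.
move=> mx mt; apply: measurable_fun_invr.
exact: (measurable_approxT (f := fun=> cst 1)).
Qed.

Lemma approx_phi_ge0 x t : 0 <= approx_phi m N h x t.
Proof. by rewrite invr_ge0 approxT_ge0. Qed.

Lemma measurable_approx_psi {d' : measure_display} {T : measurableType d'}
    (x : T -> X) (t : T -> R) :
  measurable_fun setT x -> measurable_fun setT t ->
  measurable_fun setT (fun w => approx_psi m N h (x w) (t w)).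
Proof.
move=> mx mt; apply: measurable_fun_invr.
apply: (measurable_approxT (f := fun w z => approx_phi m N h z (t w))) => //.
  by move=> w z; exact: approx_phi_ge0.
apply: measurable_approx_phi => //; exact: measurableT_comp.
Qed.

Lemma approx_psi_ge0 x t : 0 <= approx_psi m N h x t.
Proof. by rewrite invr_ge0 approxT_ge0// => z; exact: approx_phi_ge0. Qed.

Lemma measurable_approx_kernel {d' : measure_display} {T : measurableType d'}
    (x y : T -> X) (t : T -> R) :
  measurable_fun setT x -> measurable_fun setT y -> measurable_fun setT t ->
  measurable_fun setT (fun w => approx_kernel m N h (x w) (y w) (t w)).
Proof.
move=> mx my mt; apply: measurable_funM.
  apply: measurable_funM.
    by apply: measurable_funM; exact: measurable_approx_phi.
  apply: measurable_fun_invr.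
  by apply: (measurableT_comp (f := fun r : R => r `^ (2 * N))).
apply: (measurable_Rintegral_param (G := fun p => h (mdist (x p.1) p.2 / t p.1) *
   h (mdist (y p.1) p.2 / t p.1) * approx_psi m N h p.2 (t p.1))).
  by move=> p; rewrite !mulr_ge0 ?approx_psi_ge0.
apply: measurable_funM; first apply: measurable_funM.
- by apply: measurable_cutoff_mdist => //; exact: measurableT_comp.
- by apply: measurable_cutoff_mdist => //; exact: measurableT_comp.
- by apply: measurable_approx_psi => //; exact: measurableT_comp.
Qed.

Lemma approx_kernel_ge0 x y t : 0 <= approx_kernel m N h x y t.
Proof.
apply: mulr_ge0.
  by rewrite divr_ge0 ?mulr_ge0 ?approx_phi_ge0 ?powR_ge0.
by apply: Rintegral_ge0 => z _; rewrite !mulr_ge0 ?approx_psi_ge0.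
Qed.

(** The two factors [h] vanish from distance 2t on, and no [z] is closer than 2t to both points. *)
Lemma approx_kernel_eq0 x y t : 0 < t -> 4 * t <= mdist x y ->
  approx_kernel m N h x y t = 0.
Proof.
move=> t0 xy; rewrite /approx_kernel [X in _ * X](_ : _ = 0) ?mulr0//.
rewrite /Rintegral integral0_eq// => z _.
have [xz|xz] := leP (2 * t) (mdist x z).
  by rewrite h_eq0 ?mul0r// ler_pdivlMr.
rewrite (h_eq0 (r := mdist y z / t)) ?mulr0 ?mul0r// ler_pdivlMr//.
by have := metric_triangle x z y; rewrite (metric_sym z y); lra.
Qed.

(** The single constant of the kernel estimates: t^-N m(B(x, 2t)) <= A on the ball outside which the
    cutoff vanishes, and t^-N m(B(x, t/2)) >= 1/A on the ball where it equals 1. *)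
Let A := c * 2 `^ N.

Let A0 : 0 < A. Proof. by rewrite mulr_gt0// powR_gt0. Qed.

Let scale t : 0 < t -> t `^ (- N) * (c * (2 * t) `^ N) = A.
Proof.
move=> t0; rewrite powRM// ?(ltW t0)// powRN mulrCA [_^-1 * _]mulrCA.
by rewrite mulVf ?mulr1// gt_eqF// powR_gt0.
Qed.

Let scaleV t : 0 < t -> t `^ (- N) * (c^-1 * (t / 2) `^ N) = A^-1.
Proof.
move=> t0; have V2 : (2^-1 : R) `^ N = (2 `^ N)^-1.
  by rewrite -powR_inv1// -powRrM mulN1r powRN.
rewrite powRM ?invr_ge0 ?(ltW t0)// V2 powRN /A invfM.
by rewrite mulrCA mulKf ?gt_eqF ?powR_gt0.
Qed.

Section bounded_functions.
Variables (f : X -> R) (M : R) (t : R).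
Hypotheses (t0 : 0 < t) (mf : measurable_fun setT f) (fM : forall z, `|f z| <= M).

Let M0 : 0 <= M. Proof. exact: le_trans (fM point). Qed.

Let mu x : measurable_fun setT (fun z => h (mdist x z / t) * f z).
Proof. by apply: measurable_funM => //; exact: measurable_cutoff_mdist. Qed.

Let uM x z : `|h (mdist x z / t) * f z| <= M.
Proof.
by rewrite normrM -[leRHS]mul1r ler_pM// ger0_norm.
Qed.

Let uB x z : ~ ball x (2 * t) z -> h (mdist x z / t) * f z = 0.
Proof.
rewrite ballEmdist/= => /negP; rewrite -leNgt => xz.
by rewrite h_eq0 ?mul0r// ler_pdivlMr.
Qed.

Let mB x : (m (ball x (2 * t)) <= (c * (2 * t) `^ N)%:E)%E.
Proof. by apply: (ahlfors_ball_le mreg); rewrite mulr_gt0. Qed.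

Lemma integrable_approxT x :
  m.-integrable setT (EFin \o (fun z => h (mdist x z / t) * f z)).
Proof.
exact: (integrable_le_support (measurable_metric_ball x (2 * t)) (mB x) M0
  (mu x) (uM x) (@uB x)).
Qed.

Lemma normr_approxT_le x : `|approxT m N h t f x| <= A * M.
Proof.
rewrite normrM ger0_norm ?powR_ge0// -(scale t0) -mulrA.
rewrite ler_wpM2l ?powR_ge0// mulrC.
exact: (normr_Rintegral_le_support (measurable_metric_ball x (2 * t)) (mB x) M0
  (mu x) (uM x) (@uB x)).
Qed.

(** Only the ball of radius t/2 is kept, where the cutoff equals 1; its measure is bounded below by
    regularity. *)
Lemma approxT_ge (lo : R) x : 0 <= lo -> (forall z, lo <= f z) ->
  A^-1 * lo <= approxT m N h t f x.
Proof.
move=> lo0 lof; rewrite -(scaleV t0) -mulrA ler_wpM2l ?powR_ge0//.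
rewrite -lee_fin /Rintegral fineK; last first.
  by apply: integrable_fin_num => //; exact: integrable_approxT.
apply: (@le_trans _ _ (\int[m]_z (lo%:E * (\1_(ball x (t / 2)) z)%:E))%E).
  rewrite ge0_integralZl//; last first.
    by apply/measurable_EFinP/measurable_indic; exact: measurable_metric_ball.
  rewrite integral_indic ?setIT//; last exact: measurable_metric_ball.
  rewrite mulrC EFinM lee_wpmul2l//.
  by apply: (ahlfors_ball_ge mreg); rewrite divr_gt0.
apply: ge0_le_integral => //.
- by move=> z _; rewrite -EFinM lee_fin mulr_ge0.
- apply: measurable_funeM; apply/measurable_EFinP/measurable_indic.
  exact: measurable_metric_ball.
- exact/measurable_EFinP.
move=> z _; rewrite -EFinM lee_fin indicE.
have [|_] := boolP (z \in _); last by rewrite mulr0 mulr_ge0// (le_trans lo0).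
rewrite inE ballEmdist/= mulr1 => xz.
by rewrite h_eq1 ?mul1r// ler_pdivrMr// mulrC ltW.
Qed.

(** The two cutoffs differ by at most L d(x, y) / t, and only on the union of the balls of radius 2t
    around [x] and [y]. The factor 2 counts these balls. *)
Lemma approxT_dist x y :
  `|approxT m N h t f x - approxT m N h t f y| <=
  2 * A * L * M * (mdist x y / t).
Proof.
rewrite -mulrBr -RintegralB//; [|exact: integrable_approxT..].
rewrite normrM ger0_norm ?powR_ge0//.
have -> : 2 * A * L * M * (mdist x y / t) = t `^ (- N) *
    (L * (mdist x y / t) * M * (2 * (c * (2 * t) `^ N))).
  by rewrite -(scale t0); ring.
rewrite ler_wpM2l ?powR_ge0//.
apply: (normr_Rintegral_le_support
    (B := ball x (2 * t) `|` ball y (2 * t))) => //.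
- by apply: measurableU; exact: measurable_metric_ball.
- rewrite (le_trans (measureU2 _ _ _))//; try exact: measurable_metric_ball.
  by rewrite [2 * (c * _)]mulr_natl mulr2n EFinD leeD ?mB.
- by rewrite !mulr_ge0 ?invr_ge0 ?mdist_ge0// ltW.
- by apply: measurable_funB; exact: mu.
- move=> z; rewrite -mulrBl normrM ler_pM// (le_trans (hL _ _))//.
  rewrite ler_wpM2l// -mulrBl normrM.
  rewrite (ger0_norm (x := t^-1)) ?invr_ge0 ?(ltW t0)//.
  by rewrite ler_wpM2r ?invr_ge0 ?(ltW t0)// ler_dist_mdist.
- move=> z /not_orP[xz yz]; by rewrite !uB ?subrr.
Qed.

End bounded_functions.

Section positive_scale.
Variable t : R.
Hypothesis t0 : 0 < t.

Let powR_double : t `^ (2 * N) = t `^ N * t `^ N.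
Proof. by rewrite mulr_natl mulr2n powRD // lt0r_neq0 ?implybT. Qed.

Let m1 : measurable_fun [set: X] (cst (1 : R)). Proof. exact: measurable_cst. Qed.

Let normr1_le (z : X) : `|cst (1 : R) z| <= 1. Proof. by rewrite /cst normr1. Qed.

Let mphi : measurable_fun [set: X] (approx_phi m N h ^~ t).
Proof. exact: measurable_approx_phi. Qed.

Let mpsi : measurable_fun [set: X] (approx_psi m N h ^~ t).
Proof. exact: measurable_approx_psi. Qed.

Lemma approxT1_ge x : A^-1 <= approxT m N h t (cst 1) x.
Proof. by rewrite -[leLHS]mulr1 (approxT_ge t0 m1 normr1_le). Qed.

Lemma approxT1_gt0 x : 0 < approxT m N h t (cst 1) x.
Proof. by rewrite (lt_le_trans _ (approxT1_ge x))// invr_gt0. Qed.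

Lemma approx_phi_le x : approx_phi m N h x t <= A.
Proof.
by rewrite -[leRHS]invrK lef_pV2 ?posrE ?invr_gt0 ?approxT1_gt0 ?approxT1_ge.
Qed.

Lemma approx_phi_ge x : A^-1 <= approx_phi m N h x t.
Proof.
rewrite lef_pV2 ?posrE ?approxT1_gt0// (le_trans (ler_norm _))//.
by rewrite -[leRHS]mulr1 normr_approxT_le.
Qed.

Let normr_phi_le x : `|approx_phi m N h x t| <= A.
Proof. by rewrite ger0_norm ?approx_phi_ge0// approx_phi_le. Qed.

Let approxT_phi_ge x : A^-1 * A^-1 <= approxT m N h t (approx_phi m N h ^~ t) x.
Proof.
rewrite (approxT_ge t0 mphi normr_phi_le)//; first by rewrite invr_ge0 ltW.
exact: approx_phi_ge.
Qed.

Lemma approxT_phi_gt0 x : 0 < approxT m N h t (approx_phi m N h ^~ t) x.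
Proof. by rewrite (lt_le_trans _ (approxT_phi_ge x))// mulr_gt0 ?invr_gt0. Qed.

Lemma approx_psi_le x : approx_psi m N h x t <= A * A.
Proof.
rewrite -[leRHS]invrK lef_pV2 ?posrE ?invr_gt0 ?approxT_phi_gt0 ?mulr_gt0//.
by rewrite invfM approxT_phi_ge.
Qed.

Let F y z := h (mdist y z / t) * approx_psi m N h z t.

Let mF y : measurable_fun setT (F y).
Proof. by apply: measurable_funM => //; exact: measurable_cutoff_mdist. Qed.

Let FM y z : `|F y z| <= A * A.
Proof.
rewrite /F normrM -[leRHS]mul1r ler_pM//; first by rewrite ger0_norm.
by rewrite ger0_norm ?approx_psi_ge0// approx_psi_le.
Qed.

(** Read this way, the first variable enters only through phi and through T_t applied to a function
    bounded by A^2, so the estimates for bounded functions apply to both. *)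
Lemma approx_kernelE x y : approx_kernel m N h x y t =
  t `^ (- N) * approx_phi m N h x t * approx_phi m N h y t *
  approxT m N h t (F y) x.
Proof.
rewrite /approx_kernel /approxT /F.
under [in RHS]eq_Rintegral do rewrite mulrA.
rewrite powR_double.
by rewrite powRN invfM; ring.
Qed.

(** Product rule: px Ix - py Iy = px (Ix - Iy) + (px - py) Iy. The first term produces A^5 and the
    second A^7. *)
Lemma approx_kernel_dist x y z :
  `|approx_kernel m N h x z t - approx_kernel m N h y z t| <=
  2 * L * (A ^+ 5 + A ^+ 7) * t `^ (- N) * (mdist x y / t).
Proof.
rewrite !approx_kernelE.
set px := approx_phi m N h x t; set py := approx_phi m N h y t.
set pz := approx_phi m N h z t; set Ix := approxT _ _ _ _ _ x.
set Iy := approxT _ _ _ _ _ y; set D := mdist x y / t.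
have D0 : 0 <= D by rewrite divr_ge0 ?mdist_ge0 ?ltW.
have pxA : `|px| <= A := normr_phi_le x.
have pyA : `|py| <= A := normr_phi_le y.
have pzA : `|pz| <= A := normr_phi_le z.
have IyA : `|Iy| <= A * (A * A) := normr_approxT_le t0 (mF z) (FM z) y.
have IxyA : `|Ix - Iy| <= 2 * A * L * (A * A) * D :=
  approxT_dist t0 (mF z) (FM z) x y.
have pxyA : `|px - py| <= A * A * (2 * A * L * D).
  (* phi inverts T_t 1, so a difference of phi is a difference of T_t 1 times two values of phi,
     each at most [A]. *)
  have -> : px - py = px * py *
      (approxT m N h t (cst 1) y - approxT m N h t (cst 1) x).
    rewrite /px /py /approx_phi; field.
    by rewrite !gt_eqF// approxT1_gt0.
  rewrite normrM ler_pM//; first by rewrite normrM ler_pM.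
  have := approxT_dist t0 m1 normr1_le x y.
  by rewrite mulr1 distrC.
have -> : t `^ (- N) * px * pz * Ix - t `^ (- N) * py * pz * Iy =
    t `^ (- N) * (pz * (px * (Ix - Iy) + (px - py) * Iy)) by ring.
rewrite normrM (ger0_norm (powR_ge0 _ _)).
have -> : 2 * L * (A ^+ 5 + A ^+ 7) * t `^ (- N) * D =
    t `^ (- N) * (A * (A * (2 * A * L * (A * A) * D) +
      A * A * (2 * A * L * D) * (A * (A * A)))) by ring.
rewrite ler_wpM2l ?powR_ge0// normrM ler_pM// (le_trans (ler_normD _ _))//.
by rewrite lerD// normrM ler_pM.
Qed.

(** This is what phi and psi are designed for. Integrating in [y] first turns phi(y, t) into t^N T_t
    phi(z), which psi(z, t) cancels; the remaining integral in [z] is t^N T_t 1(x), which phi(x, t)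
    cancels. *)
Lemma integral_approx_kernel x : (\int[m]_y (approx_kernel m N h x y t)%:E = 1)%E.
Proof.
pose k := approx_phi m N h x t / t `^ (2 * N).
have k0 : 0 <= k by rewrite divr_ge0 ?approx_phi_ge0 ?powR_ge0.
pose G (p : X * X) := k * approx_phi m N h p.1 t *
  (h (mdist x p.2 / t) * F p.1 p.2).
have F0 y z : 0 <= F y z by rewrite mulr_ge0 ?approx_psi_ge0.
have G0 p : 0 <= G p.
  by apply: mulr_ge0; [rewrite mulr_ge0 ?approx_phi_ge0|exact: mulr_ge0].
have mG : measurable_fun setT G.
  apply: measurable_funM.
    by apply: measurable_funM => //; exact: measurable_approx_phi.
  apply: measurable_funM; first exact: measurable_cutoff_mdist.
  apply: measurable_funM; first exact: measurable_cutoff_mdist.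
  exact: measurable_approx_psi.
transitivity (\int[m]_y \int[m]_z (EFin \o G) (y, z))%E.
  apply: eq_integral => y _ /=.
  have intF := integrable_approxT t0 (mF y) (FM y) x.
  transitivity (\int[m]_z ((k * approx_phi m N h y t)%:E *
      (h (mdist x z / t) * F y z)%:E))%E; last first.
    by apply: eq_integral => z _; rewrite -EFinM.
  rewrite ge0_integralZl//; last 3 first.
  - by apply: measurable_int intF.
  - by move=> z _; rewrite lee_fin mulr_ge0.
  - by rewrite lee_fin mulr_ge0 ?approx_phi_ge0.
  rewrite -[X in (_ * X)%E]fineK; last exact: integrable_fin_num intF.
  rewrite -EFinM; congr EFin; rewrite /approx_kernel /k.
  rewrite [in LHS](mulrAC (approx_phi m N h x t)).
  by congr (_ * _); apply: eq_Rintegral => z _; rewrite mulrA.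
transitivity (\int[m]_z \int[m]_y (EFin \o G) (y, z))%E.
  apply: (fubini_tonelli (m1 := m) (m2 := m)); first exact/measurable_EFinP.
  by move=> p; rewrite lee_fin.
(* Target after psi has cancelled T_t phi. The factor [cst 1] keeps the integrand in the shape of
   T_t 1. *)
transitivity (\int[m]_z ((k * t `^ N)%:E * (h (mdist x z / t) * cst 1 z)%:E))%E.
  apply: eq_integral => z _ /=.
  have intphi := integrable_approxT t0 mphi normr_phi_le z.
  transitivity (\int[m]_y ((k * (h (mdist x z / t) * approx_psi m N h z t))%:E *
      (h (mdist z y / t) * approx_phi m N h y t)%:E))%E.
    apply: eq_integral => y _; rewrite -EFinM /G /F/= (metric_sym z y).
    by congr EFin; ring.
  rewrite ge0_integralZl//; last 3 first.
  - by apply: measurable_int intphi.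
  - by move=> y _; rewrite lee_fin mulr_ge0// approx_phi_ge0.
  - by rewrite lee_fin mulr_ge0// mulr_ge0 ?approx_psi_ge0.
  rewrite -[X in (_ * X)%E]fineK; last exact: integrable_fin_num intphi.
  rewrite -!EFinM; congr EFin.
  have Tphi : fine (\int[m]_y (h (mdist z y / t) * approx_phi m N h y t)%:E) =
      t `^ N * approxT m N h t (approx_phi m N h ^~ t) z.
    by rewrite /approxT powRN mulVKf// gt_eqF// powR_gt0.
  rewrite Tphi /approx_psi /cst/=; field.
  by rewrite gt_eqF// approxT_phi_gt0.
have int1 := integrable_approxT t0 m1 normr1_le x.
rewrite ge0_integralZl//; last 3 first.
- by apply: measurable_int int1.
- by move=> y _; rewrite lee_fin mulr_ge0// ler01.
- by rewrite lee_fin mulr_ge0// powR_ge0.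
rewrite -[X in (_ * X)%E]fineK; last exact: integrable_fin_num int1.
have T1 : fine (\int[m]_z (h (mdist x z / t) * cst 1 z)%:E) =
    t `^ N * approxT m N h t (cst 1) x.
  by rewrite /approxT powRN mulVKf// gt_eqF// powR_gt0.
rewrite T1 -EFinM; congr EFin; rewrite /k /approx_phi.
rewrite powR_double.
by field; rewrite !gt_eqF ?approxT1_gt0 ?powR_gt0.
Qed.

End positive_scale.

End approximation_kernel.

(** * Potentials of mixtures of kernels *)

Section weight.
Context {R : realType}.
Notation leb := (@lebesgue_measure R).
Variable alpha : R.
Hypothesis alpha0 : 0 < alpha.
Implicit Type t : R.

(** The density of k_alpha in [t], extended by 0 so that mixtures are integrals over the whole line
    and the product measure needs no restriction. *)
Definition bessel_weight t : R :=
  if 0 < t then alpha * (t `^ alpha / (1 + t `^ alpha) ^+ 2 / t) else 0.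

Lemma bessel_weight_le0 t : t <= 0 -> bessel_weight t = 0.
Proof. by rewrite /bessel_weight leNgt => /negbTE ->. Qed.

Lemma bessel_weight_ge0 t : 0 <= bessel_weight t.
Proof.
rewrite /bessel_weight; case: ifP => // t0.
by rewrite mulr_ge0 ?(ltW alpha0)// !divr_ge0 ?exprn_ge0 ?addr_ge0 ?powR_ge0 ?ltW.
Qed.

Lemma bessel_weight_le_pos t : 0 < t ->
  bessel_weight t <= alpha * t `^ (alpha - 1).
Proof.
move=> t0; rewrite /bessel_weight t0 ler_wpM2l ?(ltW alpha0)//.
rewrite powRB; last by rewrite lt0r_neq0 ?implybT.
rewrite powRr1 ?(ltW t0)// ler_wpM2r ?invr_ge0 ?(ltW t0)//.
rewrite ler_pdivrMr; last by rewrite exprn_gt0// ltr_wpDr ?powR_ge0.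
by rewrite ler_peMr ?powR_ge0// exprn_ege1// lerDl powR_ge0.
Qed.

(** Here the denominator is bounded below by t^(2 alpha) instead of 1: decay at infinity, needed for
    the total mass to be finite. *)
Lemma bessel_weight_le_neg t : 0 < t ->
  bessel_weight t <= alpha * t `^ (- alpha - 1).
Proof.
move=> t0; rewrite /bessel_weight t0 ler_wpM2l ?(ltW alpha0)//.
rewrite powRB; last by rewrite lt0r_neq0 ?implybT.
rewrite powRr1 ?(ltW t0)// ler_wpM2r ?invr_ge0 ?(ltW t0)//.
have ta : 0 < t `^ alpha by rewrite powR_gt0.
rewrite ler_pdivrMr; last by rewrite exprn_gt0// ltr_wpDr ?powR_ge0.
rewrite powRN ler_pdivlMl// -expr2 lerXn2r ?nnegrE ?addr_ge0 ?(ltW ta)//.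
by rewrite lerDr.
Qed.

Lemma measurable_bessel_weight : measurable_fun [set: R] bessel_weight.
Proof.
have mp a : measurable_fun [set: R] (fun t => t `^ a) by [].
have -> : bessel_weight = (fun t => \1_`]0, +oo[ t *
    (alpha * (t `^ alpha / (1 + t `^ alpha) ^+ 2 / t))).
  apply/funext => t; rewrite /bessel_weight indicE mem_setE in_itv/= andbT.
  by case: ifP; rewrite ?mul1r ?mul0r.
apply: measurable_funM; first exact: measurable_indic.
apply: measurable_funM => //.
apply: measurable_funM; last exact: measurable_fun_invr.
apply: measurable_funM => //; apply: measurable_fun_invr.
by apply: measurable_funX; exact: measurable_funD.
Qed.

(** The exact value is 1 (substitute u = t^alpha), but a crude bound suffices: each side of t = 1
    contributes at most 1. *)
Lemma integral_bessel_weight_le : (\int[leb]_t (bessel_weight t)%:E <= 2%:E)%E.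
Proof.
have -> : (2%:E : \bar R) = (alpha * (1 `^ alpha / alpha) +
    alpha * (1 `^ (- alpha) / alpha))%:E.
  by rewrite !powR1 !mul1r mulfV ?lt0r_neq0.
apply: integral_le_powR => //; rewrite ?(ltW alpha0)//.
- by apply/measurable_EFinP; exact: measurable_bessel_weight.
- by move=> t; rewrite lee_fin bessel_weight_ge0.
- by move=> t t0; rewrite bessel_weight_le0.
- by move=> t t0 _; rewrite lee_fin bessel_weight_le_pos.
- by move=> t t1; rewrite lee_fin bessel_weight_le_neg// (lt_trans _ t1).
Qed.

End weight.

(** * Potentials of an abstract family of kernels [S] of mass 1 at scale [t] *)

Section potential.
Context {d : measure_display} {R : realType} {X : borelMetricType d R}.
Notation leb := (@lebesgue_measure R).
Variables (m : {sigma_finite_measure set X -> \bar R}) (N c K alpha beta : R)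
  (S : X -> X -> R -> R).
Hypotheses (c0 : 0 < c) (ball_le : forall (x : X) (r : R), 0 < r ->
  (m (ball x r) <= (c * r `^ N)%:E)%E).
Hypotheses (alpha0 : 0 < alpha) (beta0 : 0 < beta) (alpha_beta : alpha + beta < 1)
  (K0 : 0 <= K).
Hypotheses
  (mS : forall x, measurable_fun [set: X * R] (fun p => S x p.1 p.2))
  (S_ge0 : forall x z t, 0 <= S x z t)
  (S_int : forall x t, 0 < t -> (\int[m]_z (S x z t)%:E = 1)%E)
  (S_supp : forall x z t, 0 < t -> 4 * t <= mdist x z -> S x z t = 0)
  (S_dist : forall x y z t, 0 < t ->
    `|S x z t - S y z t| <= K * t `^ (- N) * (mdist x y / t)).
Implicit Types (x y z : X) (t r : R) (g : X -> R).

Notation w := (bessel_weight alpha).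

Let wS x (p : X * R) : R := w p.2 * S x p.1 p.2.

Let wS_ge0 x p : 0 <= wS x p.
Proof. by rewrite mulr_ge0// bessel_weight_ge0. Qed.

Let mwS x : measurable_fun setT (wS x).
Proof.
apply: measurable_funM => //.
by apply: measurableT_comp => //; exact: measurable_bessel_weight.
Qed.

Definition mixture_kernel x z : \bar R := (\int[leb]_t (w t * S x z t)%:E)%E.

Lemma mixture_kernel_ge0 x z : (0 <= mixture_kernel x z)%E.
Proof. by apply: integral_ge0 => t _; rewrite lee_fin (wS_ge0 x (z, t)). Qed.

Lemma measurable_mixture_kernel x : measurable_fun setT (mixture_kernel x).
Proof.
apply: (measurable_fun_fubini_tonelli_F (m2 := leb) (EFin \o wS x)).
  by apply/measurable_EFinP; exact: mwS.
by move=> p; rewrite lee_fin.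
Qed.

Lemma integral_mixture_kernel x :
  (\int[m]_z mixture_kernel x z = \int[leb]_t (w t)%:E)%E.
Proof.
transitivity (\int[m]_z \int[leb]_t (EFin \o wS x) (z, t))%E; first by [].
transitivity (\int[leb]_t \int[m]_z (EFin \o wS x) (z, t))%E.
  apply: (fubini_tonelli (m1 := m) (m2 := leb)).
    by apply/measurable_EFinP; exact: mwS.
  by move=> p; rewrite lee_fin.
apply: eq_integral => t _ /=; have [t0|t0] := leP t 0.
  rewrite bessel_weight_le0// integral0_eq// => z _.
  by rewrite /wS/= bessel_weight_le0// mul0r.
transitivity (\int[m]_z ((w t)%:E * (S x z t)%:E))%E.
  by apply: eq_integral => z _; rewrite -EFinM.
rewrite ge0_integralZl// ?S_int ?mule1//.
- apply/measurable_EFinP.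
  exact: (measurableT_comp (mS x) (pair2_measurable t)).
- by move=> z _; rewrite lee_fin.
- by rewrite lee_fin bessel_weight_ge0.
Qed.

Lemma integral_mixture_kernel_le x : (\int[m]_z mixture_kernel x z <= 2%:E)%E.
Proof. by rewrite integral_mixture_kernel integral_bessel_weight_le. Qed.

Definition mixture_potential g x : R :=
  fine (\int[m]_z ((g z)%:E * mixture_kernel x z))%E.

Let gwS g x (p : X * R) : R := g p.1 * wS x p.

Let mgwS g x : measurable_fun setT g -> measurable_fun setT (gwS g x).
Proof. by move=> mg; apply: measurable_funM => //; exact: measurableT_comp. Qed.

(** Valid also where the kernel is infinite: [g z] has a fixed sign, so nonnegative integration
    applies to it or to its opposite. *)
Let integral_gwS g x z :
  (\int[leb]_t (gwS g x (z, t))%:E = (g z)%:E * mixture_kernel x z)%E.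
Proof.
have msec : measurable_fun setT (fun t => (w t * S x z t)%:E).
  apply/measurable_EFinP.
  exact: (measurableT_comp (mwS x) (pair1_measurable z)).
have sec0 t : (0 <= (w t * S x z t)%:E)%E by rewrite lee_fin (wS_ge0 x (z, t)).
have [g0|g0] := leP 0 (g z).
  by rewrite -ge0_integralZl.
rewrite -[g z]opprK EFinN mulNe -ge0_integralZl//; last first.
  by rewrite lee_fin oppr_ge0 ltW.
rewrite -integral_ge0N; last first.
  by move=> t _; rewrite mule_ge0// lee_fin oppr_ge0 ltW.
by apply: eq_integral => t _; rewrite -EFinM -EFinN /gwS/= mulNr opprK.
Qed.

Let integral_normr_gwS g x z :
  (\int[leb]_t `|(gwS g x (z, t))%:E| = `|(g z)%:E * mixture_kernel x z|)%E.
Proof.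
rewrite abseM (gee0_abs (mixture_kernel_ge0 x z)).
rewrite -(integral_gwS (fun z => `|g z|)).
apply: eq_integral => t _.
by rewrite /gwS/= normrM (ger0_norm (wS_ge0 _ _)).
Qed.

(** By Tonelli, absolute convergence of the potential at [x] amounts to integrability over [X * R].
    From here on differences of potentials are integrals of real functions. *)
Let integrable_gwS g x : measurable_fun setT g ->
  m.-integrable setT (fun z => (g z)%:E * mixture_kernel x z)%E ->
  (m \x leb)%E.-integrable setT (EFin \o gwS g x).
Proof.
move=> mg /integrableP[_ gk]; apply/integrable12ltyP.
  by apply/measurable_EFinP; exact: mgwS.
by under eq_integral do rewrite integral_normr_gwS.
Qed.

Let mixture_potentialE g x : measurable_fun setT g ->
  m.-integrable setT (fun z => (g z)%:E * mixture_kernel x z)%E ->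
  mixture_potential g x = \int[(m \x leb)%E]_p gwS g x p.
Proof.
move=> mg gk; rewrite /mixture_potential /Rintegral; congr fine.
rewrite -(integral12_prod_meas1 (integrable_gwS mg gk)).
by apply: eq_integral => z _; rewrite -integral_gwS.
Qed.

Lemma integrable_bounded_mixture g (M : R) x : measurable_fun setT g ->
  (forall z, `|g z| <= M) ->
  m.-integrable setT (fun z => (g z)%:E * mixture_kernel x z)%E.
Proof.
move=> mg gM; have M0 : 0 <= M := le_trans (normr_ge0 _) (gM point).
have mk := measurable_mixture_kernel x; have k0 := mixture_kernel_ge0 x.
have mgk : measurable_fun setT (fun z => (g z)%:E * mixture_kernel x z)%E.
  by apply: emeasurable_funM => //; exact/measurable_EFinP.
apply/integrableP; split => //.
apply: (@le_lt_trans _ _ (\int[m]_z (M%:E * mixture_kernel x z))%E).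
  apply: ge0_le_integral => //.
  - exact: measurableT_comp.
  - exact: measurable_funeM.
  - by move=> z _; rewrite abseM (gee0_abs (k0 z)) lee_wpmul2r ?lee_fin.
rewrite ge0_integralZl// (@le_lt_trans _ _ (M%:E * 2%:E)%E)//.
  by rewrite lee_wpmul2l// integral_mixture_kernel_le.
by rewrite -EFinM ltry.
Qed.

Lemma normr_mixture_potential_le g (M : R) x : measurable_fun setT g ->
  (forall z, `|g z| <= M) -> `|mixture_potential g x| <= M * 2.
Proof.
move=> mg gM; have M0 : 0 <= M := le_trans (normr_ge0 _) (gM point).
have gk := integrable_bounded_mixture x mg gM.
have mk := measurable_mixture_kernel x; have k0 := mixture_kernel_ge0 x.
have fgk : (\int[m]_z ((g z)%:E * mixture_kernel x z))%E \is a fin_num.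
  exact: integrable_fin_num.
rewrite -lee_fin EFinM -[leLHS]/(`|(mixture_potential g x)%:E|)%E fineK//.
rewrite (le_trans (le_abse_integral _ _ _))//; first by case/integrableP: gk.
apply: (@le_trans _ _ (\int[m]_z (M%:E * mixture_kernel x z))%E).
  apply: ge0_le_integral => //.
  - by apply: measurableT_comp => //; case/integrableP: gk.
  - exact: measurable_funeM.
  - by move=> z _; rewrite abseM (gee0_abs (k0 z)) lee_wpmul2r ?lee_fin.
by rewrite ge0_integralZl// lee_wpmul2l// integral_mixture_kernel_le.
Qed.

(* Linearity is read off the integral over the product space: [mixture_kernel]
   may be infinite, so that the integrands themselves need not add up. *)
Lemma mixture_potential_linear (a : R) g1 g2 x :
  measurable_fun setT g1 -> measurable_fun setT g2 ->
  m.-integrable setT (fun z => (g1 z)%:E * mixture_kernel x z)%E ->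
  m.-integrable setT (fun z => (g2 z)%:E * mixture_kernel x z)%E ->
  m.-integrable setT (fun z => (a * g1 z + g2 z)%:E * mixture_kernel x z)%E ->
  mixture_potential (fun z => a * g1 z + g2 z) x =
  a * mixture_potential g1 x + mixture_potential g2 x.
Proof.
move=> mg1 mg2 i1 i2 i12.
have I1 := integrable_gwS mg1 i1; have I2 := integrable_gwS mg2 i2.
rewrite (mixture_potentialE mg1 i1) (mixture_potentialE mg2 i2).
rewrite mixture_potentialE//; last first.
  by apply: measurable_funD => //; exact: measurable_funM.
rewrite -RintegralZl// -RintegralD//; last exact: integrableZl I1.
by apply: eq_Rintegral => p _; rewrite /gwS mulrDl mulrA.
Qed.

(** * The Hölder estimate for a pair of distinct points *)

Section holder_estimate.
Variables (g : X -> R) (G : R) (x y : X).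
Hypotheses (G0 : 0 <= G) (mg : measurable_fun setT g)
  (gG : forall z1 z2, `|g z1 - g z2| <= G * mdist z1 z2 `^ beta)
  (xy : x != y)
  (gx : m.-integrable setT (fun z => (g z)%:E * mixture_kernel x z)%E)
  (gy : m.-integrable setT (fun z => (g z)%:E * mixture_kernel y z)%E).

Let r := mdist x y.

Let r0 : 0 < r. Proof. by rewrite mdist_gt0. Qed.

Let D (p : X * R) : R := (g p.1 - g x) * (wS x p - wS y p).

Let mD : measurable_fun setT D.
Proof.
apply: measurable_funM; last exact: measurable_funB.
by apply: measurable_funB => //; exact: measurableT_comp.
Qed.

(* The kernels of x and y have the same total mass, so subtracting the constant
   [g x] from [g] does not change the difference of the potentials. *)
Let potentialB : mixture_potential g x - mixture_potential g y =
  \int[(m \x leb)%E]_p D p.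
Proof.
have int1 z : m.-integrable setT
    (fun z' => (cst (1 : R) z')%:E * mixture_kernel z z')%E.
  apply: (@integrable_bounded_mixture _ 1) => //.
  by move=> ?; rewrite normr1.
have m1 : measurable_fun [set: X] (cst (1 : R)) by exact: measurable_cst.
have Ix := integrable_gwS mg gx; have Iy := integrable_gwS mg gy.
have I1x := integrable_gwS m1 (int1 x); have I1y := integrable_gwS m1 (int1 y).
have mass z :
    \int[(m \x leb)%E]_p gwS (cst 1) z p = fine (\int[leb]_t (w t)%:E)%E.
  rewrite -(mixture_potentialE m1 (int1 z)) -(integral_mixture_kernel z).
  by congr fine; apply: eq_integral => z' _; rewrite mul1e.
have IB := integrableB measurableT Ix Iy.
have I1B := integrableB measurableT I1x I1y.
rewrite (mixture_potentialE mg gx) (mixture_potentialE mg gy) -RintegralB//.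
rewrite -[LHS]subr0 -(mulr0 (g x)) -(subrr (fine (\int[leb]_t (w t)%:E)%E)).
rewrite -{1}(mass x) -(mass y) -RintegralB// -RintegralZl//.
rewrite -RintegralB//; last first.
  exact: integrableZl I1B.
by apply: eq_Rintegral => p _; rewrite /gwS /D /cst; ring.
Qed.

Let Phi t : \bar R := (\int[m]_z `|D (z, t)|%:E)%E.

Let mPhi : measurable_fun setT Phi.
Proof.
apply: (measurable_fun_fubini_tonelli_G (m1 := m) (fun p => `|D p|%:E)).
  by apply/measurable_EFinP; exact: measurableT_comp.
by move=> p; rewrite lee_fin.
Qed.

Let Phi_ge0 t : (0 <= Phi t)%E.
Proof. by apply: integral_ge0 => z _; rewrite lee_fin. Qed.

(** If the right-hand side is infinite there is nothing to prove; otherwise Tonelli makes [D]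
    integrable, and its integral can be bounded by that of its absolute value. *)
Let potentialB_le :
  (`|mixture_potential g x - mixture_potential g y|%:E <= \int[leb]_t Phi t)%E.
Proof.
have [Doo|Dfin] := eqVneq (\int[leb]_t Phi t)%E +oo%E; first by rewrite Doo leey.
have absD : (\int[m \x leb]_p `|D p|%:E = \int[leb]_t Phi t)%E.
  apply: (fubini_tonelli2 (m1 := m) (m2 := leb) (fun p => `|D p|%:E)).
    by apply/measurable_EFinP; exact: measurableT_comp.
  by move=> p; rewrite lee_fin.
have ID : (m \x leb)%E.-integrable setT (EFin \o D).
  apply/integrableP; split; first exact/measurable_EFinP.
  by rewrite absD ltey.
rewrite potentialB EFin_normr_Rintegral// -absD.
by apply: le_abse_integral => //; exact/measurable_EFinP.
Qed.

Let Phi_le0 t : t <= 0 -> Phi t = 0%E.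
Proof.
move=> t0; apply: integral0_eq => z _.
by rewrite /D /wS/= bessel_weight_le0// !mul0r subrr mulr0 normr0.
Qed.

Let DE z t : D (z, t) = (g z - g x) * w t * (S x z t - S y z t).
Proof. by rewrite /D /wS/=; ring. Qed.

Let near_ball z (rho : R) : mdist x z < rho -> `|g z - g x| <= G * rho `^ beta.
Proof.
move=> zrho; rewrite (le_trans (gG _ _))// ler_wpM2l// metric_sym.
by rewrite ge0_ler_powR ?nnegrE ?mdist_ge0 ?ltW// (le_lt_trans _ zrho) ?mdist_ge0.
Qed.

(** No cancellation is exploited at small scales: the difference of the kernels is bounded by their
    sum, of mass 2. The radius 5r is the support radius 4t <= 4r plus the distance r from [y] to
    [x]. *)
Let Phi_small t : 0 < t -> t <= r ->
  (Phi t <= (2 * G * (5 * r) `^ beta * alpha * t `^ (alpha - 1))%:E)%E.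
Proof.
move=> t0 tr; pose M := G * (5 * r) `^ beta * w t.
have M0 : 0 <= M by rewrite !mulr_ge0 ?powR_ge0 ?bessel_weight_ge0.
have msec z : measurable_fun setT (fun z' => (S z z' t)%:E).
  apply/measurable_EFinP.
  exact: (measurableT_comp (mS z) (pair2_measurable t)).
have sec0 z z' : (0 <= (S z z' t)%:E)%E by rewrite lee_fin.
apply: (@le_trans _ _ (\int[m]_z (M%:E * ((S x z t)%:E + (S y z t)%:E)))%E).
  apply: ge0_le_integral => //.
  - apply/measurable_EFinP; apply: measurableT_comp => //.
    exact: (measurableT_comp mD (pair2_measurable t)).
  - by apply: measurable_funeM; exact: emeasurable_funD.
  move=> z _; rewrite -EFinD -EFinM lee_fin DE.
  have [zr|zr] := leP (5 * r) (mdist x z).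
    rewrite !S_supp// ?subrr ?mulr0 ?normr0 ?addr0 ?mulr0//; last lra.
    by have := metric_triangle x y z; rewrite -/r; lra.
  rewrite !normrM ler_pM//; last first.
    by rewrite (le_trans (ler_normB _ _))// !ger0_norm.
  rewrite (ger0_norm (bessel_weight_ge0 _ _))// ler_wpM2r ?bessel_weight_ge0//.
  exact: near_ball.
rewrite ge0_integralZl//; last 2 first.
- exact: emeasurable_funD.
- by move=> z _; rewrite adde_ge0.
rewrite ge0_integralD// !S_int// -EFinD -EFinM lee_fin.
rewrite (_ : M * (1 + 1) = 2 * G * (5 * r) `^ beta * w t); last first.
  by rewrite /M; ring.
rewrite -[leRHS]mulrA ler_wpM2l ?mulr_ge0 ?powR_ge0//.
exact: bessel_weight_le_pos.
Qed.

Let Phi_large t : r < t ->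
  (Phi t <= (G * 5 `^ beta * 5 `^ N * c * K * r * alpha *
    t `^ (- (1 - (alpha + beta)) - 1))%:E)%E.
Proof.
move=> rt; have t0 : 0 < t := lt_trans r0 rt.
pose M := G * (5 * t) `^ beta * w t * (K * t `^ (- N) * (r / t)).
have M0 : 0 <= M.
  rewrite /M !mulr_ge0 ?powR_ge0 ?bessel_weight_ge0 ?invr_ge0//.
    exact: ltW.
  exact: ltW.
have D0 z : 5 * t <= mdist x z -> D (z, t) = 0.
  move=> zt; rewrite DE !S_supp// ?subrr ?mulr0//; last lra.
  by have := metric_triangle x y z; rewrite -/r; lra.
apply: (@le_trans _ _ (M * (c * (5 * t) `^ N))%:E).
  apply: (integral_normr_le_support (B := ball x (5 * t))) => //.
  - exact: measurable_metric_ball.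
  - by apply: ball_le; rewrite mulr_gt0.
  - exact: (measurableT_comp mD (pair2_measurable t)).
  - move=> z; have [/D0->|zt] := leP (5 * t) (mdist x z); first by rewrite normr0.
    rewrite DE !normrM ler_pM// ?S_dist//.
    rewrite (ger0_norm (bessel_weight_ge0 _ _))//.
    by rewrite ler_wpM2r ?bessel_weight_ge0// near_ball.
  - by move=> z; rewrite ballEmdist/= => /negP; rewrite -leNgt => /D0.
rewrite lee_fin.
(* The volume t^N of the ball cancels the t^-N of the Lipschitz bound; the gain r / t is what
   remains of the cancellation between the kernels. *)
have -> : M * (c * (5 * t) `^ N) =
    G * 5 `^ beta * 5 `^ N * c * K * r * (t `^ beta / t * w t).
  rewrite /M !powRM ?(ltW t0)// powRN.
  by field; rewrite !gt_eqF ?powR_gt0.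
rewrite -[leRHS]mulrA ler_wpM2l//.
  by rewrite !mulr_ge0 ?powR_ge0// ltW.
(* t^beta comes from [g], 1/t from the kernel difference and t^(alpha - 1) from the weight. *)
rewrite (_ : _ - 1 = beta + (- 1) + (alpha - 1)); last by ring.
have tE : forall a b, t `^ (a + b) = t `^ a * t `^ b.
  by move=> a b; rewrite powRD// lt0r_neq0 ?implybT.
rewrite tE (tE beta) powR_inv1 ?(ltW t0)// mulrCA.
rewrite ler_wpM2l ?bessel_weight_le_pos//.
by rewrite divr_ge0 ?powR_ge0 ?ltW.
Qed.

(** Both ranges yield the same power: r^beta r^alpha from t <= r, and r r^(alpha + beta - 1) from t
    > r. The factor alpha of the weight cancels the 1/alpha of the first integral; the second leaves
    1/(1 - (alpha + beta)). *)
Lemma mixture_potential_dist_le :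
  `|mixture_potential g x - mixture_potential g y| <=
  (2 * 5 `^ beta + alpha * 5 `^ beta * 5 `^ N * c * K / (1 - (alpha + beta))) *
  G * r `^ (alpha + beta).
Proof.
have b0 : 0 < 1 - (alpha + beta) by rewrite subr_gt0.
rewrite -lee_fin (le_trans potentialB_le)//.
have := @integral_le_powR R Phi alpha (1 - (alpha + beta))
  (2 * G * (5 * r) `^ beta * alpha) (G * 5 `^ beta * 5 `^ N * c * K * r * alpha)
  r alpha0 b0 r0 _ _ mPhi Phi_ge0 Phi_le0 Phi_small Phi_large.
move=> /(_ _ _)/le_trans; apply; last first.
- rewrite lee_fin powRM ?(ltW r0)// opprB.
  have rE : forall a b, r `^ (a + b) = r `^ a * r `^ b.
    by move=> a b; rewrite powRD// lt0r_neq0 ?implybT.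
  rewrite !rE powR_inv1 ?(ltW r0)//.
  rewrite le_eqVlt; apply/orP; left; apply/eqP; field.
  by rewrite !lt0r_neq0.
- by rewrite !mulr_ge0 ?powR_ge0// ltW.
- by rewrite !mulr_ge0 ?powR_ge0// ltW.
Qed.

End holder_estimate.

End potential.

(** * Bessel potentials *)

Section holder_functions.
Context {R : realType} {X : metricType R}.
Implicit Types (beta : R) (g : X -> R) (x y : X).

Lemma holder_dist_le beta g x y : 0 < beta -> lipschitz_exp beta g ->
  `|g x - g y| <= holder_seminorm beta g * mdist x y `^ beta.
Proof.
move=> beta0 gl; have [->|xy] := eqVneq x y.
  by rewrite subrr normr0 mdistxx powR0 ?mulr0// lt0r_neq0.
rewrite -ler_pdivrMr; last by rewrite powR_gt0// mdist_gt0.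
by apply: ub_le_sup => //; exists (x, y).
Qed.

Lemma holder_seminorm_ge0 beta g : 0 <= holder_seminorm beta g.
Proof.
rewrite /holder_seminorm.
(* If the quotients are empty or unbounded, [sup] takes its default value 0. *)
have [[[a Aa] ubA]|/sup_out->//] := pselect (has_sup (holder_quotients beta g)).
apply: le_trans (ub_le_sup ubA Aa).
by case: Aa => p _ <-; rewrite divr_ge0 ?powR_ge0.
Qed.

Lemma holder_seminorm_le beta g (C : R) : 0 <= C ->
  (forall x y, `|g x - g y| <= C * mdist x y `^ beta) ->
  lipschitz_exp beta g /\ holder_seminorm beta g <= C.
Proof.
move=> C0 gC.
have ubC : ubound (holder_quotients beta g) C.
  move=> _ [[x y] /= xy <-]; rewrite ler_pdivrMr ?gC//.
  by rewrite powR_gt0// mdist_gt0.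
split; first by exists C.
(* There are no quotients when [X] has no two distinct points. *)
have [Q0|/set0P Q0] := eqVneq (holder_quotients beta g) set0.
  by rewrite /holder_seminorm Q0 sup0.
exact: ge_sup.
Qed.

(** The source of Borel measurability of [g], which the passage to the product space requires. *)
Lemma holder_continuous beta g : 0 < beta -> lipschitz_exp beta g -> continuous g.
Proof.
move=> beta0 gl x; apply/cvgrPdist_lt => e e0.
(* The added 1 allows division by [G] when [g] is constant. *)
pose G := holder_seminorm beta g + 1.
have G0 : 0 < G by rewrite ltr_wpDl ?holder_seminorm_ge0.
apply/nbhs_ballP; exists ((e / G) `^ beta^-1) => /=.
  by rewrite powR_gt0// divr_gt0.
move=> y; rewrite ballEmdist/= => xy.
rewrite (le_lt_trans (holder_dist_le x y beta0 gl))//.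
rewrite (@le_lt_trans _ _ (G * mdist x y `^ beta))//.
  by rewrite ler_wpM2r ?powR_ge0// lerDl.
rewrite -ltr_pdivlMl// mulrC.
have -> : e / G = ((e / G) `^ beta^-1) `^ beta.
  by rewrite -powRrM mulVf ?lt0r_neq0// powRr1// divr_ge0 ?ltW.
by rewrite gt0_ltr_powR ?nnegrE ?mdist_ge0 ?powR_ge0.
Qed.

Lemma normr_le_sup_norm g x : has_ubound (abs_range g) -> `|g x| <= sup_norm g.
Proof. by move=> gb; apply: ub_le_sup => //; exists x. Qed.

Lemma sup_norm_le g (M : R) : 0 <= M -> (forall x, `|g x| <= M) ->
  has_ubound (abs_range g) /\ sup_norm g <= M.
Proof.
move=> M0 gM; have ubM : ubound (abs_range g) M by move=> _ [x _ <-].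
split; first by exists M.
have [Q0|/set0P Q0] := eqVneq (abs_range g) set0; last exact: ge_sup.
by rewrite /sup_norm Q0 sup0.
Qed.

End holder_functions.

Section bessel_potential.
Context {d : measure_display} {R : realType} {X : borelMetricType d R}.
Notation leb := (@lebesgue_measure R).
Variables (m : {sigma_finite_measure set X -> \bar R}) (N c : R) (h : R -> R)
  (alpha : R).
Hypotheses (c0 : 0 < c) (mreg : forall (x : X) (r : R), 0 < r ->
  ((c^-1 * r `^ N)%:E <= m (ball x r) <= (c * r `^ N)%:E)%E).
Hypotheses (hcut : cutoff h) (alpha0 : 0 < alpha).
Implicit Types (x y z : X) (t : R) (g : X -> R).

Let H := clamp_cutoff h.
Let S := approx_kernel m N H.

Let H_ge0 := clamp_cutoff_ge0 hcut.
Let H_le1 := clamp_cutoff_le1 hcut.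
Let H_eq1 := clamp_cutoff_eq1 hcut.
Let H_eq0 := clamp_cutoff_eq0 hcut.

Let S_ge0 x y t : 0 <= S x y t. Proof. exact: approx_kernel_ge0. Qed.

Let S_int x t : 0 < t -> (\int[m]_y (S x y t)%:E = 1)%E.
Proof.
have [L L0 HL] := clamp_cutoff_lipschitz hcut.
move=> t0.
exact: (integral_approx_kernel c0 mreg H_ge0 H_le1 H_eq1 H_eq0 HL t0 x).
Qed.

Let mS x : measurable_fun [set: X * R] (fun p => S x p.1 p.2).
Proof.
have [L L0 HL] := clamp_cutoff_lipschitz hcut.
apply: (measurable_approx_kernel c0 mreg H_ge0 HL (x := fun=> x)) => //.
Qed.

Let S_supp x y t : 0 < t -> 4 * t <= mdist x y -> S x y t = 0.
Proof. exact: approx_kernel_eq0. Qed.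

(** At a positive scale the cutoff is only evaluated at ratios d / t >= 0, where clamping changes
    nothing. *)
Lemma approx_kernel_clamp x y t : 0 < t -> approx_kernel m N h x y t = S x y t.
Proof.
move=> t0; have hH (u v : X) : h (mdist u v / t) = H (mdist u v / t).
  by rewrite /H clamp_cutoffE// divr_ge0 ?mdist_ge0 ?ltW.
have TH f u : approxT m N h t f u = approxT m N H t f u.
  by congr (_ * _); apply: eq_Rintegral => z _; rewrite hH.
have psiH u : approx_psi m N h u t = approx_psi m N H u t.
  rewrite /approx_psi TH; congr (approxT m N H t _ u)^-1.
  by apply/funext => z; rewrite TH.
have phiH u : approx_phi m N h u t = approx_phi m N H u t.
  by rewrite /approx_phi TH.
have intH :
    \int[m]_z (h (mdist x z / t) * h (mdist y z / t) * approx_psi m N h z t) =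
    \int[m]_z (H (mdist x z / t) * H (mdist y z / t) * approx_psi m N H z t).
  by apply: eq_Rintegral => z _; rewrite !hH psiH.
exact: (f_equal2 *%R
  (f_equal2 (fun a b => a * b / t `^ (2 * N)) (phiH x) (phiH y)) intH).
Qed.

Lemma bessel_kernelE x y :
  bessel_kernel m N h alpha x y = mixture_kernel alpha S x y.
Proof.
have msec : measurable_fun setT (fun t => S x y t).
  exact: (measurableT_comp (mS x) (pair1_measurable y)).
have mp a : measurable_fun [set: R] (fun t => t `^ a) by [].
rewrite /bessel_kernel /mixture_kernel.
transitivity (alpha%:E * \int[leb]_(t in `]0%R, +oo[)
    (t `^ alpha / (1 + t `^ alpha) ^+ 2 * S x y t / t)%:E)%E.
  apply: congr1; apply: eq_integral => t.
  rewrite inE/= in_itv/= andbT => t0.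
  exact: (congr1 (fun s => (t `^ alpha / (1 + t `^ alpha) ^+ 2 * s / t)%:E)
    (approx_kernel_clamp x y t0)).
rewrite -ge0_integralZl//; last 3 first.
- apply: (measurable_funS measurableT) => //; apply/measurable_EFinP.
  apply: measurable_funM; last exact: measurable_fun_invr.
  apply: measurable_funM => //; apply: measurable_funM => //.
  apply: measurable_fun_invr.
  by apply: measurable_funX; exact: measurable_funD.
- move=> t; rewrite /= in_itv/= andbT => t0; rewrite lee_fin.
  rewrite divr_ge0 ?(ltW t0)// mulr_ge0// divr_ge0 ?powR_ge0//.
  by rewrite exprn_ge0 ?addr_ge0 ?powR_ge0.
- by rewrite lee_fin ltW.
rewrite integral_mkcond; apply: eq_integral => t _.
rewrite patchE /bessel_weight mem_setE in_itv/= andbT.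
case: ifP => [t0|_]; last by rewrite mul0r.
by rewrite -EFinM; congr EFin; ring.
Qed.

Let intE g x : ((fun z => (g z)%:E * bessel_kernel m N h alpha x z) =
  (fun z => (g z)%:E * mixture_kernel alpha S x z))%E.
Proof. by apply/funext => z; rewrite bessel_kernelE. Qed.

Let potE g x : bessel_potential m N h alpha g x = mixture_potential m alpha S g x.
Proof. by rewrite /bessel_potential intE. Qed.

Let wdE g x : bessel_well_defined m N h alpha g ->
  m.-integrable setT (fun z => (g z)%:E * mixture_kernel alpha S x z)%E.
Proof. by move=> /(_ x); rewrite intE. Qed.

Lemma bessel_well_defined_bounded g (M : R) : measurable_fun setT g ->
  (forall z, `|g z| <= M) -> bessel_well_defined m N h alpha g.
Proof.
move=> mg gM x; rewrite intE.
exact: (integrable_bounded_mixture alpha0 mS S_ge0 S_int x mg gM).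
Qed.

Lemma normr_bessel_potential_le g (M : R) x : measurable_fun setT g ->
  (forall z, `|g z| <= M) -> `|bessel_potential m N h alpha g x| <= M * 2.
Proof.
move=> mg gM; rewrite potE.
exact: (normr_mixture_potential_le alpha0 mS S_ge0 S_int x mg gM).
Qed.

Lemma bessel_potential_linear (a : R) g1 g2 x :
  measurable_fun setT g1 -> measurable_fun setT g2 ->
  bessel_well_defined m N h alpha g1 -> bessel_well_defined m N h alpha g2 ->
  bessel_well_defined m N h alpha (fun z => a * g1 z + g2 z) ->
  bessel_potential m N h alpha (fun z => a * g1 z + g2 z) x =
  a * bessel_potential m N h alpha g1 x + bessel_potential m N h alpha g2 x.
Proof.
move=> mg1 mg2 g1k g2k gk; rewrite !potE.
exact: (mixture_potential_linear alpha0 mS S_ge0 mg1 mg2 (wdE x g1k) (wdE x g2k)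
  (wdE x gk)).
Qed.

Lemma bessel_potential_holder beta : 0 < beta -> alpha + beta < 1 ->
  exists2 C : R, 0 < C & forall g, lipschitz_exp beta g ->
    bessel_well_defined m N h alpha g -> forall x y,
    `|bessel_potential m N h alpha g x - bessel_potential m N h alpha g y|
    <= C * holder_seminorm beta g * mdist x y `^ (alpha + beta).
Proof.
move=> beta0 ab1; have [L L0 HL] := clamp_cutoff_lipschitz hcut.
pose A := c * 2 `^ N; pose K := 2 * L * (A ^+ 5 + A ^+ 7).
have A0 : 0 <= A by rewrite mulr_ge0 ?powR_ge0 ?ltW.
have K0 : 0 <= K by rewrite !mulr_ge0 ?addr_ge0 ?exprn_ge0.
have S_dist x y z t : 0 < t ->
    `|S x z t - S y z t| <= K * t `^ (- N) * (mdist x y / t).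
  move=> t0.
  exact: (approx_kernel_dist c0 mreg H_ge0 H_le1 H_eq1 H_eq0 L0 HL).
have b0 : 0 < 1 - (alpha + beta) by rewrite subr_gt0.
(* The constant of [mixture_potential_dist_le], with [K] from [approx_kernel_dist]; it is fixed
   before [g] is introduced. *)
exists (2 * 5 `^ beta +
    alpha * 5 `^ beta * 5 `^ N * c * K / (1 - (alpha + beta))).
  rewrite ltr_pwDl ?mulr_gt0 ?powR_gt0// divr_ge0 ?(ltW b0)//.
  apply: mulr_ge0 K0; apply: mulr_ge0 (ltW c0).
  by rewrite !mulr_ge0 ?powR_ge0 ?(ltW alpha0).
move=> g gl gdef x y; rewrite !potE.
have [->|xy] := eqVneq x y.
  by rewrite subrr normr0 mdistxx powR0 ?mulr0// lt0r_neq0// addr_gt0.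
have mg : measurable_fun setT g.
  exact/continuous_measurable_metric/(holder_continuous beta0 gl).
apply: (mixture_potential_dist_le c0 (ahlfors_ball_le mreg) alpha0 beta0 ab1 K0
  mS S_ge0 S_int S_supp S_dist (holder_seminorm_ge0 beta g) mg _ xy
  (wdE x gdef) (wdE y gdef)).
by move=> z1 z2; exact: holder_dist_le.
Qed.

End bessel_potential.

(** * The Bessel potential as an operator between Hölder spaces *)

Section bessel_operator.
Context {d : measure_display} {R : realType} {X : borelMetricType d R}.
Variables (m : {measure set X -> \bar R}) (N : R) (h : R -> R)
  (alpha beta C : R).
Hypotheses (beta0 : 0 < beta) (C0 : 0 <= C).
Hypothesis wd : forall (g : X -> R) (M : R), measurable_fun setT g ->
  (forall z, `|g z| <= M) -> bessel_well_defined m N h alpha g.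
Hypothesis bound : forall (g : X -> R) (M : R) x, measurable_fun setT g ->
  (forall z, `|g z| <= M) -> `|bessel_potential m N h alpha g x| <= M * 2.
Hypothesis lin : forall (a : R) (g1 g2 : X -> R) x,
  measurable_fun setT g1 -> measurable_fun setT g2 ->
  bessel_well_defined m N h alpha g1 -> bessel_well_defined m N h alpha g2 ->
  bessel_well_defined m N h alpha (fun z => a * g1 z + g2 z) ->
  bessel_potential m N h alpha (fun z => a * g1 z + g2 z) x =
  a * bessel_potential m N h alpha g1 x + bessel_potential m N h alpha g2 x.
Hypothesis holder : forall g : X -> R, lipschitz_exp beta g ->
  bessel_well_defined m N h alpha g -> forall x y,
  `|bessel_potential m N h alpha g x - bessel_potential m N h alpha g y|
  <= C * holder_seminorm beta g * mdist x y `^ (alpha + beta).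

Implicit Types u v : holder_space X beta.

Let lip u : lipschitz_exp beta u.
Proof. by have /asboolP[] := holder_funP u. Qed.

Let mu u : measurable_fun setT (u : X -> R).
Proof. exact/continuous_measurable_metric/(holder_continuous beta0 (lip u)). Qed.

Let le_sup u z : `|u z| <= sup_norm u.
Proof. by apply: normr_le_sup_norm; have /asboolP[] := holder_funP u. Qed.

Let sup_ge0 u : 0 <= sup_norm u.
Proof. exact: le_trans (normr_ge0 _) (le_sup u point). Qed.

Lemma bessel_well_defined_holder u : bessel_well_defined m N h alpha u.
Proof. exact: wd (mu u) (le_sup u). Qed.

Let Jfun u : X -> R^o := bessel_potential m N h alpha u.

Let J_sup u : has_ubound (abs_range (Jfun u)) /\
  sup_norm (Jfun u) <= sup_norm u * 2.
Proof.
apply: sup_norm_le => [|x]; first by rewrite mulr_ge0.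
exact: bound (mu u) (le_sup u).
Qed.

Let J_semi u : lipschitz_exp (alpha + beta) (Jfun u) /\
  holder_seminorm (alpha + beta) (Jfun u) <= C * holder_seminorm beta u.
Proof.
apply: holder_seminorm_le; first by rewrite mulr_ge0// holder_seminorm_ge0.
by move=> x y; exact: holder (lip u) (bessel_well_defined_holder u) x y.
Qed.

Let J_holder u : Jfun u \in holder_pred (alpha + beta).
Proof. by apply/asboolP; split; [case: (J_sup u)|case: (J_semi u)]. Qed.

Definition bessel_operator u : holder_space X (alpha + beta) :=
  HolderSpace (J_holder u).

Lemma bessel_operator_linear : linear bessel_operator.
Proof.
move=> a u v; apply/val_inj/funext => x.
have valE : (a *: u + v : holder_space X beta) =
    (fun z => a * u z + v z) :> (X -> R).
  exact: (linearP (val : holder_space X beta -> (X -> R^o)) a u v).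
have wdl := bessel_well_defined_holder (a *: u + v); rewrite valE in wdl.
rewrite /= /Jfun valE.
exact: (lin x (mu u) (mu v) (bessel_well_defined_holder u)
  (bessel_well_defined_holder v) wdl).
Qed.

(** The sup norm costs the factor 2 that bounds the mass of the kernel, and the seminorm costs the
    Hölder constant [C]. *)
Lemma normr_bessel_operator_le u : `|bessel_operator u| <= (2 + C) * `|u|.
Proof.
rewrite !holder_normE /holder_norm.
have [_ s1] := J_sup u; have [_ s2] := J_semi u.
rewrite (le_trans (lerD s1 s2))// mulrDl mulrC lerD//.
  by rewrite ler_wpM2l// lerDl holder_seminorm_ge0.
by rewrite ler_wpM2l// lerDr sup_ge0.
Qed.

Lemma bessel_operator_exists :
  exists J : {linear holder_space X beta -> holder_space X (alpha + beta)},
    (forall u x, J u x = bessel_potential m N h alpha u x) /\ continuous J.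
Proof.
pose linJ := GRing.isLinear.Build R (holder_space X beta)
  (holder_space X (alpha + beta)) _ bessel_operator bessel_operator_linear.
pose J : {linear holder_space X beta -> holder_space X (alpha + beta)} :=
  HB.pack bessel_operator linJ.
exists J; split => //.
apply/linear_bounded_continuous/linear_boundedP; near=> r => u.
rewrite (le_trans (normr_bessel_operator_le u))// ler_wpM2r//.
Unshelve. all: by end_near. Qed.

End bessel_operator.

Theorem proposition3p2 (d : measure_display) (R : realType)
    (X : borelMetricType d R) (m : {measure set X -> \bar R}) (N : R)
    (h : R -> R) (alpha beta : R) :
  m setT = +oo%E -> 0 < N -> ahlfors_regular m N -> cutoff h ->
  0 < alpha -> 0 < beta -> alpha + beta < 1 ->
  (exists2 C : R, 0 < C &
     forall g : X -> R, lipschitz_exp beta g ->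
       bessel_well_defined m N h alpha g ->
       forall x y : X,
         `|bessel_potential m N h alpha g x - bessel_potential m N h alpha g y|
         <= C * holder_seminorm beta g * mdist x y `^ (alpha + beta)) /\
  (forall g : holder_space X beta, bessel_well_defined m N h alpha g) /\
  (exists J : {linear holder_space X beta -> holder_space X (alpha + beta)},
     (forall (g : holder_space X beta) (x : X),
        J g x = bessel_potential m N h alpha g x) /\
     continuous J).
Proof.
move=> _ _ [c c0 mreg] hcut alpha0 beta0 ab1.
have m_sigma := ahlfors_sigma_finite mreg point.
pose sf := isSFinite.Build _ _ _ _ (sfinite_measure_sigma_finite m_sigma).
pose sgf := isSigmaFinite.Build _ _ _ _ m_sigma.
(* The same measure, now carrying the sigma-finite structure that Fubini asks for; statements about
   [ms] are statements about [m] by conversion. *)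
pose ms := HB.pack_for (SigmaFiniteMeasure.type X R) (Measure.sort m) sf sgf.
have [C C0 holder] :=
  @bessel_potential_holder _ _ _ ms _ _ _ _ c0 mreg hcut alpha0 _ beta0 ab1.
have wd := @bessel_well_defined_bounded _ _ _ ms _ _ _ _ c0 mreg hcut alpha0.
have bound := @normr_bessel_potential_le _ _ _ ms _ _ _ _ c0 mreg hcut alpha0.
have lin := @bessel_potential_linear _ _ _ ms _ _ _ _ c0 mreg hcut alpha0.
split; first by exists C.
split; first by move=> g; exact: (bessel_well_defined_holder beta0 wd).
exact: (bessel_operator_exists beta0 (ltW C0) wd bound lin holder).
Qed.
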